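(* Assume (A1)–(A4), $P^\star\in\Pi_{K^\star}\setminus\Pi_{K^\star-1}$ with $K^\star<\infty$, and that the penalty has the form $\mathrm{pen}(n,K)=v_nD(K)$ where $D:\mathbb N\to\mathbb R$, $(v_n)$ is an increasing sequence of positive numbers with $v_n=o(n)$, and there exist $A\ge1$, $\delta\in(0,1)$ with $v_{nk}\le Ak^{1-\delta}v_n$ for all $k,n\ge1$. Suppose also (i) the classes $\mathcal G^b_K$ admit an envelope function belonging to $\mathcal L_\tau(P^\star)$ and (ii) $\log n=o(v_n)$. (a) If $\mathcal G^b_{K^\star+1}$ is $P^\star$-Donsker, then $\limsup_{n\to\infty}v_n^{-1}\log P^\star\{\widehat K_n^L>K^\star\}<0$. (b) If $K^\star\le K_{\max}$ and $\mathcal G^b_{K_{\max}}$ is $P^\star$-Donsker, then $\limsup_{n\to\infty}v_n^{-1}\log P^\star\{\widehat K_n^G>K^\star\}<0$.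
   Context: Setting: $(\mathcal Z,\mathcal F)$ is a Polish space with its Borel $\sigma$-field and $\mu$ a $\sigma$-finite measure on it. $Z_1,Z_2,\dots$ are i.i.d. $\mathcal Z$-valued random variables with common law $P^\star\ll\mu$, density $p^\star$, $\ell^\star=\log p^\star$; $P^\star$ also denotes the law of the whole sequence. $\{(\Theta_K,d)\}_{K\ge1}$ is an increasing (nested) sequence of metric spaces, $\Theta_\infty=\bigcup_K\Theta_K$; for $\theta\in\Theta_\infty$, $P_\theta$ is a probability measure with density $p_\theta$ w.r.t. $\mu$ and $\ell_\theta=\log p_\theta$. $\Pi_K=\{P_\theta:\theta\in\Theta_K\}$, $\Pi_0=\emptyset$. The order of $P^\star$ is $K^\star=\min\{K:P^\star\in\Pi_K\}$. $\lambda f=\int f\,d\lambda$. $H(P|Q)=\int\log(dP/dQ)\,dP$ if $P\ll Q$ and $+\infty$ otherwise. Given a penalty $\mathrm{pen}(n,K)>0$, $\mathrm{crit}(n,K)=\sup_{\theta\in\Theta_K}\sum_{i=1}^n\ell_\theta(Z_i)-\mathrm{pen}(n,K)$, $\widehat K_n^L=\inf\{K\ge1:\mathrm{crit}(n,K)\ge\mathrm{crit}(n,K+1)\}$, and $\widehat K_n^G$ is the smallest maximizer of $K\mapsto\mathrm{crit}(n,K)$ (the maximization being over $1\le K\le K_{\max}$ when a known bound $K_{\max}\ge K^\star$ is assumed). All suprema are assumed measurable. Standing assumptions: (A1) each $(\Theta_K,d)$ is compact and each $\Pi_K$ is compact for the weak topology; (A2) for each $z$ and $K$, $\theta\mapsto\ell_\theta(z)$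 is continuous on $\Theta_K$; (A3) there are $l,u:\mathcal Z\to\mathbb R$ with $u-l\in L^1(P^\star)$, $l\le\ell^\star\le u$ and $l\le\ell_\theta\le u$ for all $\theta\in\Theta_\infty$; (A4) for each $n$, $\mathrm{pen}(n,\cdot)$ is increasing, and for each $K$, $\mathrm{pen}(n,K)\to\infty$ and $\mathrm{pen}(n,K)=o(n)$ as $n\to\infty$. Additional notation: $\tau(s)=e^{|s|}-|s|-1$, $\mathcal L_\tau(P^\star)=\{f:\mathcal Z\to\mathbb R:\exists a>0,\ P^\star\tau(f/a)<\infty\}$. $H(\theta)=H(P^\star|P_\theta)$; $\mathcal G^b_K=\{(\ell_\theta-\ell^\star)/H(\theta)^{1/2}:\theta\in\Theta_K,\ H(\theta)>0\}$. An envelope of a class $\mathcal G$ is $G$ with $|g|\le G$ for all $g\in\mathcal G$. ''$P^\star$-Donsker'' is the standard notion for a class of functions. *)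

(* Defs.v *)
From HB Require Import structures.
From mathcomp Require Import all_boot all_order all_algebra.
From mathcomp Require Import all_classical all_reals all_analysis.
Set Implicit Arguments. Unset Strict Implicit. Unset Printing Implicit Defensive.
Import Order.TTheory GRing.Theory Num.Theory.
Import numFieldNormedType.Exports.
Local Open Scope classical_set_scope.
Local Open Scope ring_scope.

Definition is_metric (R : realType) (T : Type) (dZ : T -> T -> R) : Prop :=
  [/\ (forall x y, 0 <= dZ x y), (forall x y, dZ x y = 0 <-> x = y),
      (forall x y, dZ x y = dZ y x) & (forall x y z, dZ x z <= dZ x y + dZ y z)].

Definition dopen (R : realType) (T : Type) (dZ : T -> T -> R) (A : set T) : Prop :=
  forall x, A x -> exists2 e : R, 0 < e & forall y, dZ x y < e -> A y.

Definition dcvg (R : realType) (T : Type) (dZ : T -> T -> R) (s : nat -> T) (x : T) : Prop :=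
  forall e : R, 0 < e -> exists N, forall n, (N <= n)%N -> dZ (s n) x < e.

Definition dcauchy (R : realType) (T : Type) (dZ : T -> T -> R) (s : nat -> T) : Prop :=
  forall e : R, 0 < e -> exists N, forall n m, (N <= n)%N -> (N <= m)%N -> dZ (s n) (s m) < e.

Definition polish_borel (R : realType) (d : measure_display) (Z : measurableType d)
    (dZ : Z -> Z -> R) : Prop :=
  [/\ is_metric dZ,
      (forall s, dcauchy dZ s -> exists x, dcvg dZ s x),
      (exists D : set Z, countable D /\
          forall x (e : R), 0 < e -> exists2 y, D y & dZ x y < e)
    & (@measurable d Z = <<s dopen dZ >>)].

Definition cover_compact (T : Type) (isopen : set T -> Prop) (A : set T) : Prop :=
  forall (I : Type) (U : I -> set T), (forall i, isopen (U i)) ->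
    A `<=` \bigcup_i U i ->
    exists J : set I, finite_set J /\ A `<=` \bigcup_(i in J) U i.

Definition PE (R : realType) (d : measure_display) (Z : measurableType d)
    (Q : probability Z R) (f : Z -> R) : R :=
  fine (\int[Q]_x (f x)%:E).

Definition bounded_continuous (R : realType) (T : Type) (dZ : T -> T -> R) (f : T -> R) : Prop :=
  (exists M : R, forall z, `|f z| <= M) /\
  (forall x (e : R), 0 < e -> exists2 r : R, 0 < r & forall y, dZ x y < r -> `|f x - f y| < e).

Definition weak_nbhd (R : realType) (d : measure_display) (Z : measurableType d)
    (dZ : Z -> Z -> R) (Q : probability Z R) (N : set (probability Z R)) : Prop :=
  exists (k : nat) (f : nat -> Z -> R) (e : R),
    [/\ 0 < e, (forall i, (i < k)%N -> bounded_continuous dZ (f i)) &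
        [set Q' | forall i, (i < k)%N -> `|PE Q' (f i) - PE Q (f i)| < e] `<=` N].

Definition weak_open (R : realType) (d : measure_display) (Z : measurableType d)
    (dZ : Z -> Z -> R) (U : set (probability Z R)) : Prop :=
  forall Q, U Q -> weak_nbhd dZ Q U.

Definition weak_compact (R : realType) (d : measure_display) (Z : measurableType d)
    (dZ : Z -> Z -> R) (S : set (probability Z R)) : Prop :=
  cover_compact (weak_open dZ) S.

Definition iid_with_law (R : realType) (dO : measure_display) (O : measurableType dO)
    (P : probability O R) (d : measure_display) (Z : measurableType d)
    (X : nat -> O -> Z) (Q : probability Z R) : Prop :=
  [/\ (forall i, measurable_fun setT (X i)),
      (forall i A, measurable A -> P (X i @^-1` A) = Q A) &
      (forall (s : seq nat) (A : nat -> set Z), uniq s -> (forall i, measurable (A i)) ->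
         P (\bigcap_(i in [set i | i \in s]) (X i @^-1` A i)) =
         (\prod_(i <- s) P (X i @^-1` A i))%E)].

Definition emp_proc (R : realType) (dO : measure_display) (O : measurableType dO)
    (d : measure_display) (Z : measurableType d) (X : nat -> O -> Z)
    (Q : probability Z R) (n : nat) (w : O) : (Z -> R) -> R :=
  fun f => (Num.sqrt n%:R)^-1 * \sum_(i < n) (f (X i w) - PE Q f).

Definition linf_mem (R : realType) (T : Type) (F : set (T -> R)) (z : (T -> R) -> R) : Prop :=
  exists M : R, forall f, F f -> `|z f| <= M.

Definition linf_dist (R : realType) (T : Type) (F : set (T -> R)) (z1 z2 : (T -> R) -> R) : R :=
  sup [set `|z1 f - z2 f| | f in F].

Definition linf_open (R : realType) (T : Type) (F : set (T -> R)) (U : set ((T -> R) -> R)) : Prop :=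
  U `<=` linf_mem F /\
  forall z, U z -> exists2 e : R, 0 < e &
    forall z', linf_mem F z' -> linf_dist F z z' < e -> U z'.

Definition linf_bounded_continuous (R : realType) (T : Type) (F : set (T -> R))
    (h : ((T -> R) -> R) -> R) : Prop :=
  (exists M : R, forall z, `|h z| <= M) /\
  (forall z, linf_mem F z -> forall e : R, 0 < e -> exists2 r : R, 0 < r &
     forall z', linf_mem F z' -> linf_dist F z z' < r -> `|h z - h z'| < e).

Definition outer_E (R : realType) (dO : measure_display) (O : measurableType dO)
    (P : probability O R) (Y : O -> R) : \bar R :=
  ereal_inf [set (\int[P]_w (U w)%:E)%E |
             U in [set U : O -> R | measurable_fun setT U /\ forall w, Y w <= U w]].

(* F is Donsker for the law Q of the i.i.d. sample X (defined on (O,P)):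
   the empirical process converges weakly in l^infty(F) (in the
   Hoffmann-Jorgensen sense) to a tight Borel measurable limit. *)
Definition donsker (R : realType) (dO : measure_display) (O : measurableType dO)
    (P : probability O R) (d : measure_display) (Z : measurableType d)
    (X : nat -> O -> Z) (Q : probability Z R) (F : set (Z -> R)) : Prop :=
  exists (dO' : measure_display) (O' : measurableType dO') (P' : probability O' R)
         (G : O' -> (Z -> R) -> R),
    [/\ (forall w, linf_mem F (G w)),
        (forall U, linf_open F U -> measurable (G @^-1` U)),
        (forall e : R, 0 < e -> exists K : set ((Z -> R) -> R),
            [/\ K `<=` linf_mem F, cover_compact (linf_open F) K &
                ((1 - e)%:E <= P' (G @^-1` K))%E]) &
        (forall h, linf_bounded_continuous F h ->
           (fun n => outer_E P (fun w => h (emp_proc X Q n w))) @ \oo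
             --> (\int[P']_w (h (G w))%:E)%E)].

Definition tau (R : realType) (s : R) : R := expR `|s| - `|s| - 1.

Definition in_Ltau (R : realType) (d : measure_display) (Z : measurableType d)
    (Q : probability Z R) (g : Z -> R) : Prop :=
  measurable_fun setT g /\
  exists2 a : R, 0 < a & (\int[Q]_x (tau (g x / a))%:E < +oo)%E.

Definition envelope (R : realType) (T : Type) (F : set (T -> R)) (G : T -> R) : Prop :=
  forall g, F g -> forall z, `|g z| <= G z.

(* H(P* | P_theta) = int log(p*/p_theta) dP*   (here P* << P_theta since
   p_theta > 0 everywhere under (A3)) *)
Definition KL (R : realType) (d : measure_display) (Z : measurableType d)
    (Theta : Type) (Pstar : probability Z R) (pstar : Z -> R) (p : Theta -> Z -> R)
    (th : Theta) : \bar R :=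
  (\int[Pstar]_x (ln (pstar x) - ln (p th x))%:E)%E.

Definition Gb (R : realType) (d : measure_display) (Z : measurableType d)
    (Theta : Type) (ThetaK : nat -> set Theta) (Pstar : probability Z R)
    (pstar : Z -> R) (p : Theta -> Z -> R) (K : nat) : set (Z -> R) :=
  [set (fun z => (ln (p th z) - ln (pstar z)) / Num.sqrt (fine (KL Pstar pstar p th)))
   | th in [set th | ThetaK K th /\ (0 < KL Pstar pstar p th)%E]].

Definition loglik (R : realType) (dO : measure_display) (O : measurableType dO)
    (d : measure_display) (Z : measurableType d) (Theta : Type)
    (p : Theta -> Z -> R) (X : nat -> O -> Z) (th : Theta) (n : nat) (w : O) : R :=
  \sum_(i < n) ln (p th (X i w)).

Definition supLL (R : realType) (dO : measure_display) (O : measurableType dO)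
    (d : measure_display) (Z : measurableType d) (Theta : Type)
    (ThetaK : nat -> set Theta) (p : Theta -> Z -> R) (X : nat -> O -> Z)
    (n K : nat) (w : O) : R :=
  sup [set loglik p X th n w | th in ThetaK K].

Definition crit (R : realType) (dO : measure_display) (O : measurableType dO)
    (d : measure_display) (Z : measurableType d) (Theta : Type)
    (ThetaK : nat -> set Theta) (p : Theta -> Z -> R) (X : nat -> O -> Z)
    (pen : nat -> nat -> R) (n K : nat) (w : O) : R :=
  supLL ThetaK p X n K w - pen n K.

(* \hat K^L_n = inf {K >= 1 : crit(n,K) >= crit(n,K+1)}  (inf of empty = +oo) *)
Definition KhatL (R : realType) (dO : measure_display) (O : measurableType dO)
    (d : measure_display) (Z : measurableType d) (Theta : Type)
    (ThetaK : nat -> set Theta) (p : Theta -> Z -> R) (X : nat -> O -> Z)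
    (pen : nat -> nat -> R) (n : nat) (w : O) : \bar R :=
  ereal_inf [set (K%:R)%:E | K in [set K : nat | (1 <= K)%N /\
       crit ThetaK p X pen n K.+1 w <= crit ThetaK p X pen n K w]].

Definition KhatG (R : realType) (dO : measure_display) (O : measurableType dO)
    (d : measure_display) (Z : measurableType d) (Theta : Type)
    (ThetaK : nat -> set Theta) (p : Theta -> Z -> R) (X : nat -> O -> Z)
    (pen : nat -> nat -> R) (Kmax n : nat) (w : O) : \bar R :=
  ereal_inf [set (K%:R)%:E | K in [set K : nat | (1 <= K <= Kmax)%N /\
       forall K', (1 <= K' <= Kmax)%N ->
         crit ThetaK p X pen n K' w <= crit ThetaK p X pen n K w]].

Definition elog (R : realType) (x : \bar R) : \bar R :=
  if x == 0%E then -oo%E else (ln (fine x))%:E.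

(* Main.v *)
Require Import Defs.
From HB Require Import structures.
From mathcomp Require Import all_boot all_order all_algebra.
From mathcomp Require Import all_classical all_reals all_analysis.
From mathcomp Require Import measurable_realfun ring lra.
Import Order.TTheory GRing.Theory Num.Theory.
Import numFieldNormedType.Exports.
Local Open Scope classical_set_scope.
Local Open Scope ring_scope.

(** Overestimating the order forces [sup_theta sum_i (l_theta - l_star)(Z_i) > c v_n]
    with [c = D(K_star + 1) - D(K_star)]. Writing [h = H(theta)^(1/2)], the sum is
    [h S - n h^2] with [S] the centered sum of an element of the class G^b, so that
    [S > 2 (c v_n n)^(1/2)]: a moderate deviation of the empirical process.

    By the Donsker property the normalized supremum of the empirical process is bounded
    in probability, and with the exponential envelope an Ottaviani/Hoffmann-Jorgensen
    restart argument upgrades this to [E exp(lambda ||nu_m||) <= 4] for all [m], with a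
    fixed [lambda > 0]. Cutting the sample into [k] (of the order of [v_n]) independent
    blocks of size [m = n / k] and applying the exponential Markov inequality to the sum
    of the block suprema gives the bound [exp(- c' v_n)]. Continuity in theta and
    compactness reduce every supremum to finite families. *)

(** * Independent sequences *)

(** The threshold is the same for all theta because [h S - n h^2 <= S^2 / (4 n)] whatever h is:
    completing the square removes h, and no peeling over the size of H(theta) is required.

    The order of k comes from a balance. The Markov exponent is proportional to
    [m^(-1/2) (v_n n)^(1/2)], that is to [(k v_n)^(1/2)], while the k blocks cost a factor [4^k].
    With [k = kappa v_n] the gain is of order [kappa^(1/2) v_n] and the cost of order [kappa v_n],
    so a small kappa wins.

    The functions are unbounded, so the jump at a first passage has to be paid for. At the scale
    [lambda / m^(1/2)] the part of the exponential moment of the envelope carried by large values is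
    O(1/m), and m steps add up to a constant that can be made small.

    Parameters with H(theta) = 0 have no normalized version in G^b, and densities are determined
    only almost everywhere; both defects are confined to one null set of sample paths. *)

Definition cylinder {d} {Z : measurableType d} : set (set (nat -> Z)) :=
  [set C | exists (n : nat) (A : nat -> set Z),
    [/\ forall i, measurable (A i), forall i, (n <= i)%N -> A i = setT &
        C = [set w | forall i, A i (w i)]]].

Notation seqspace Z := (g_sigma_algebraType (@cylinder _ Z)).

Definition seqcat {Z : Type} (k : nat) (x : (nat -> Z) * (nat -> Z)) : nat -> Z :=
  fun i => if (i < k)%N then x.1 i else x.2 (i - k)%N.

Definition seqshift {Z : Type} (k : nat) (w : nat -> Z) : nat -> Z :=
  fun i => w (k + i)%N.

Lemma seqshift_cat {Z : Type} k (x : (nat -> Z) * (nat -> Z)) :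
  seqshift k (seqcat k x) = x.2.
Proof.
by apply/funext => i; rewrite /seqshift /seqcat ltnNge leq_addr/= addKn.
Qed.

Definition push_measure {d d'} {T1 : measurableType d} {T2 : measurableType d'}
    {R : realType} (m : {measure set T1 -> \bar R}) {f : T1 -> T2}
    (mf : measurable_fun setT f) : {measure set T2 -> \bar R} :=
  measure_function_pushforward__canonical__measure_function_Measure m mf.

Lemma ge0_integral_push_measure {d d'} {T1 : measurableType d} {T2 : measurableType d'}
    {R : realType} (m : {measure set T1 -> \bar R}) {f : T1 -> T2}
    (mf : measurable_fun setT f) (F : T2 -> \bar R) :
  measurable_fun setT F -> (forall y, (0 <= F y)%E) ->
  (\int[push_measure m mf]_y F y = \int[m]_x F (f x))%E.
Proof. by move=> mF F0; rewrite ge0_integral_pushforward. Qed.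

Section seqspace_lemmas.
Context {d} {Z : measurableType d}.

Lemma measurable_to_seqspace {d'} {T : measurableType d'} (f : T -> seqspace Z) :
  (forall i, measurable_fun setT (fun x => f x i)) -> measurable_fun setT f.
Proof.
move=> mf; apply: (@measurability _ _ T (seqspace Z) setT f cylinder) => //.
move=> _ [_ [n [A [mA _ ->]]] <-]; rewrite setTI.
rewrite (_ : _ @^-1` _ = \bigcap_i ((fun x => f x i) @^-1` A i)); last first.
  by apply/seteqP; split => x /= h; [move=> i _; exact: h|move=> i; exact: h].
by apply: bigcapT_measurable => i; rewrite -[X in measurable X]setTI; exact: mf.
Qed.

Lemma measurable_coord i : measurable_fun setT (fun w : seqspace Z => w i).
Proof.
move=> _ A mA; rewrite setTI; apply: sub_sigma_algebra.
exists i.+1, (fun j => if j == i then A else setT); split.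
- by move=> j; case: ifP.
- by move=> j ij; case: eqP => // ji; rewrite ji ltnn in ij.
- apply/seteqP; split => w /=.
    by move=> Aw j; case: eqP => // ->.
  by move=> /(_ i); rewrite eqxx.
Qed.

Lemma measurable_seqshift k :
  measurable_fun setT (seqshift k : seqspace Z -> seqspace Z).
Proof. by apply: measurable_to_seqspace => i; exact: measurable_coord. Qed.

Lemma measurable_seqcat k :
  measurable_fun setT (seqcat k : seqspace Z * seqspace Z -> seqspace Z).
Proof.
apply: measurable_to_seqspace => i; rewrite /seqcat; case: (i < k)%N.
  exact: (measurableT_comp (g := fst) (measurable_coord i)).
exact: (measurableT_comp (g := snd) (measurable_coord (i - k))).
Qed.

Lemma cylinderI : setI_closed (@cylinder d Z).
Proof.
move=> _ _ [n [A [mA An ->]]] [m [B [mB Bm ->]]].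
exists (maxn n m), (fun i => A i `&` B i); split.
- by move=> i; exact: measurableI.
- by move=> i; rewrite geq_max => /andP[/An -> /Bm ->]; rewrite setTI.
- apply/seteqP; split => w /=; first by move=> [Aw Bw] i; split.
  by move=> h; split => i; case: (h i).
Qed.

End seqspace_lemmas.

Section iid_law.
Context {d} {Z : measurableType d} {R : realType}.
Variables (Q : probability Z R) (L : probability (seqspace Z) R).

(** Cylinders form a pi-system generating the sigma-field, so these values determine [L]. No
    infinite product measure has to be constructed: [L] will be the image law of the given
    sample. *)
Definition iid_law := forall n (A : nat -> set Z), (forall i, measurable (A i)) ->
  (forall i, (n <= i)%N -> A i = setT) ->
  L [set w | forall i, A i (w i)] = (\prod_(i < n) Q (A i))%E.

Hypothesis iidL : iid_law.
Local Open Scope ereal_scope.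

(** The preimage of a cylinder under [seqcat k] is a rectangle [U * V] whose sides constrain the
    first k and the later coordinates, so the two measures agree on a generating pi-system. *)
Lemma iid_law_seqcat k (C : set (seqspace Z)) : measurable C ->
  L C = push_measure (L \x L) (measurable_seqcat k) C.
Proof.
move=> mC.
apply: (g_sigma_algebra_measure_unique (T := seqspace Z) cylinder _ (fun=> setT)) => //.
- by move=> A GA; exact: sub_sigma_algebra.
- by move=> _; exists 0%N, (fun=> setT); split => //; apply/seteqP; split.
- by rewrite -subTset => x _; exists 0%N.
- exact: cylinderI.
- move=> _ [n [A [mA An ->]]].
  transitivity (\prod_(i < k + n) Q (A i)).
    by apply: iidL => // i /(leq_trans (leq_addl _ _)) /An.
  set U := [set w : seqspace Z | forall i, (if (i < k)%N then A i else setT) (w i)].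
  set V := [set w : seqspace Z | forall i, A (k + i)%N (w i)].
  have mU : measurable U.
    apply: sub_sigma_algebra; exists k, (fun i => if (i < k)%N then A i else setT); split => //.
    + by move=> i; case: ifP.
    + by move=> i; rewrite leqNgt => /negbTE ->.
  have mV : measurable V.
    apply: sub_sigma_algebra; exists n, (fun i => A (k + i)%N); split => //.
    by move=> i ni; apply: An; exact: leq_trans ni (leq_addl _ _).
  have kUV : (seqcat k : seqspace Z * seqspace Z -> seqspace Z) @^-1`
      [set w | forall i, A i (w i)] = U `*` V.
    apply/seteqP; split => -[w w'] /=; rewrite /seqcat /U /V /=.
      move=> h; split => i; first by case: ifPn => // ik; have := h i; rewrite ik.
      by have := h (k + i)%N; rewrite ltnNge leq_addr /= addKn.
    move=> [hU hV] i; case: ifPn => ik; first by have := hU i; rewrite ik.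
    by have := hV (i - k)%N; rewrite subnKC// leqNgt.
  have LU : L U = \prod_(i < k) Q (A i).
    pose A' i := if (i < k)%N then A i else setT.
    rewrite (_ : L U = \prod_(i < k) Q (A' i)); last apply: (iidL k A').
    + by rewrite /A'; apply: eq_bigr => i _; rewrite ltn_ord.
    + by move=> i; rewrite /A'; case: ifP.
    + by move=> i; rewrite /A' leqNgt => /negbTE ->.
  have LV : L V = \prod_(i < n) Q (A (k + i)%N).
    apply: (iidL n (fun i => A (k + i)%N)) => // i ni; apply: An; exact: leq_trans ni (leq_addl _ _).
  rewrite big_split_ord/= -LU -LV; apply: esym.
  transitivity ((L \x L) (U `*` V)); last exact: product_measure1E.
  by rewrite -kUV.
- by move=> _; rewrite (_ : _ [set: _] = 1) ?ltry//; exact: probability_setT.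
Qed.

(* Gluing two independent samples at time [k] yields a sample: this single identity
   carries all uses of independence and stationarity. *)
Lemma integral_seqcat k (F : seqspace Z -> \bar R) :
  measurable_fun setT F -> (forall w, 0 <= F w) ->
  \int[L]_w F w = \int[L]_w \int[L]_w' F (seqcat k (w, w')).
Proof.
move=> mF F0.
transitivity (\int[push_measure (L \x L) (measurable_seqcat k)]_w F w).
  by apply: eq_measure_integral => A mA _; exact: iid_law_seqcat.
rewrite ge0_integral_push_measure// (fubini_tonelli1 (fun x : seqspace Z * seqspace Z => F (seqcat k x)))//.
exact: measurableT_comp mF (measurable_seqcat k).
Qed.

(** Independence of past and future without filtrations: the last hypothesis says that [F] reads
    only the first k coordinates, while the shifted [H] reads only the others. *)
Lemma integral_split k (F H : seqspace Z -> \bar R) :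
  measurable_fun setT F -> (forall w, 0 <= F w) ->
  measurable_fun setT H -> (forall w, 0 <= H w) ->
  (forall x, F (seqcat k x) = F x.1) ->
  \int[L]_w (F w * H (seqshift k w)) = (\int[L]_w F w) * (\int[L]_w H w).
Proof.
move=> mF F0 mH H0 Fk; rewrite (integral_seqcat k); last 2 first.
- exact: emeasurable_funM mF (measurableT_comp mH (measurable_seqshift k)).
- by move=> w; rewrite mule_ge0.
under eq_integral => w _.
  under eq_integral do rewrite Fk seqshift_cat /=.
  rewrite ge0_integralZl//.
  over.
by rewrite ge0_integralZr// integral_ge0.
Qed.

Lemma integral_coord k (F : Z -> \bar R) :
  measurable_fun setT F -> (forall z, 0 <= F z) ->
  \int[L]_w F (w k) = \int[Q]_z F z.
Proof.
move=> mF F0.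
transitivity (\int[push_measure L (@measurable_coord _ Z k)]_z F z).
  by rewrite ge0_integral_push_measure.
apply: eq_measure_integral => A mA _.
pose A' i := if i == k then A else setT.
transitivity (L [set w | forall i, A' i (w i)]).
  apply: (congr1 L); apply/seteqP; split => w /=; rewrite /A'.
    by move=> Aw i; case: eqP => // ->.
  by move=> /(_ k); rewrite eqxx.
transitivity (\prod_(i < k.+1) Q (A' i)); first apply: (iidL k.+1 A').
- by move=> i; rewrite /A'; case: ifP.
- by move=> i ki; rewrite /A' gtn_eqF.
- rewrite /A' big_ord_recr /= eqxx big1 ?mul1e// => i _.
  by rewrite ltn_eqF ?probability_setT.
Qed.
End iid_law.

(** * Exponential moments of suprema of partial sums *)

Lemma sume_const_ord {R : realType} n (x : \bar R) : (0 <= x)%E ->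
  (\sum_(i < n) x = n%:R%:E * x)%E.
Proof.
move=> x0; elim: n => [|n IH]; first by rewrite big_ord0 mul0e.
by rewrite big_ord_recr /= IH -natr1 EFinD ge0_muleDl// mul1e.
Qed.

Section measurable_helpers.
Context {d} {T : measurableType d} {R : realType}.

Lemma measurable_set_le (f g : T -> R) : measurable_fun setT f ->
  measurable_fun setT g -> measurable [set x | f x <= g x].
Proof.
by move=> mf mg; rewrite -[X in measurable X]setTI; exact: measurable_fun_le.
Qed.

Lemma measurable_set_lt (f g : T -> R) : measurable_fun setT f ->
  measurable_fun setT g -> measurable [set x | f x < g x].
Proof.
move=> mf mg; rewrite (_ : mkset _ = ~` [set x | g x <= f x]).
  by apply: measurableC; exact: measurable_set_le.
by apply/seteqP; split => x /=; rewrite ltNge => /negP.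
Qed.

Lemma measurable_set_neq (f g : T -> R) : measurable_fun setT f ->
  measurable_fun setT g -> measurable [set x | f x != g x].
Proof.
move=> mf mg; rewrite (_ : mkset _ = [set x | f x < g x] `|` [set x | g x < f x]).
  by apply: measurableU; exact: measurable_set_lt.
by apply/seteqP; split => x /=; rewrite neq_lt; [move/orP|move=> h; exact/orP].
Qed.

Lemma markov_lt (m : {measure set T -> \bar R}) (f : T -> R) (a : R) :
  measurable_fun setT f -> (forall x, 0 <= f x) -> 0 <= a ->
  (a%:E * m [set x | a < f x]%R <= \int[m]_x (f x)%:E)%E.
Proof.
move=> mf f0 a0.
have mA : measurable [set x | a < f x] by exact: measurable_set_lt.
rewrite -[X in m X]setIT -integral_indic// -ge0_integralZl_EFin//; last first.
  by apply/measurable_EFinP; exact: measurable_indic.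
apply: ge0_le_integral => //.
- by move=> x _; rewrite -EFinM lee_fin mulr_ge0.
- by apply/measurable_EFinP; apply: measurable_funM => //; exact: measurable_indic.
- exact/measurable_EFinP.
- move=> x _; rewrite -EFinM lee_fin indicE.
  case: (boolP (x \in _)); last by rewrite mulr0.
  by rewrite inE /= mulr1 => /ltW.
Qed.

Lemma measurable_bigmaxr (h : nat -> T -> R) J :
  (forall j, measurable_fun setT (h j)) ->
  measurable_fun setT (fun x => \big[Num.max/0]_(j < J) h j x).
Proof.
elim: J h => [|J IH] h mh.
  by under eq_fun do rewrite big_ord0; exact: measurable_cst.
under eq_fun do rewrite big_ord_recl /=.
apply: measurable_maxr => //.
exact: (IH (fun j => h (bump 0 j))).
Qed.

End measurable_helpers.

(** * Maxima of partial sums over a finite family of functions *)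

Section maxsum.
Context {d} {Z : measurableType d} {R : realType}.
Variables (f : nat -> Z -> R) (J : nat).

Definition psum j n (w : nat -> Z) : R := \sum_(i < n) f j (w i).

(** The absolute values make this a seminorm of the vector of partial sums, so that both the
    triangle inequality [maxsumD] and its reverse form [maxsum_le_shift] are available. *)
Definition maxsum n (w : nat -> Z) : R := \big[Num.max/0]_(j < J) `|psum j n w|.

Lemma psum_shift j k n w :
  psum j (k + n) w = psum j k w + psum j n (seqshift k w).
Proof. by rewrite /psum big_split_ord. Qed.

Lemma maxsum_ge0 n w : 0 <= maxsum n w.
Proof. exact: bigmax_ge_id. Qed.

Lemma maxsum_ge j n w : (j < J)%N -> `|psum j n w| <= maxsum n w.
Proof. by move=> jJ; apply: (bigmax_sup (Ordinal jJ)). Qed.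

Lemma maxsum0 w : maxsum 0 w = 0.
Proof.
apply/eqP; rewrite eq_le maxsum_ge0 andbT; apply: bigmax_le => // i _.
by rewrite /psum big_ord0 normr0.
Qed.

Lemma maxsumD k n w : maxsum (k + n) w <= maxsum k w + maxsum n (seqshift k w).
Proof.
apply: bigmax_le => [|j _]; first by rewrite addr_ge0 ?maxsum_ge0.
rewrite psum_shift; apply: (le_trans (ler_normD _ _)).
by apply: lerD; exact: maxsum_ge.
Qed.

Lemma maxsum_le_shift k n w : maxsum k w <= maxsum (k + n) w + maxsum n (seqshift k w).
Proof.
apply: bigmax_le => [|j _]; first by rewrite addr_ge0 ?maxsum_ge0.
rewrite -(addrK (psum j n (seqshift k w)) (psum j k w)) -psum_shift.
by apply: (le_trans (ler_normB _ _)); apply: lerD; exact: maxsum_ge.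
Qed.

Lemma maxsum_seqcat k n x : (n <= k)%N -> maxsum n (seqcat k x) = maxsum n x.1.
Proof.
move=> nk; apply: eq_bigr => j _; congr `| _ |; apply: eq_bigr => i _.
by rewrite /seqcat (leq_trans (ltn_ord i) nk).
Qed.

Hypothesis mf : forall j, measurable_fun setT (f j).

Lemma measurable_psum j n : measurable_fun setT (psum j n : seqspace Z -> R).
Proof.
apply: measurable_sum => i.
exact: measurableT_comp (mf j) (measurable_coord i).
Qed.

Lemma measurable_maxsum n : measurable_fun setT (maxsum n : seqspace Z -> R).
Proof.
apply: (measurable_bigmaxr (T := seqspace Z) (fun j w => `|psum j n w|)) => j.
by apply: measurableT_comp => //; exact: measurable_psum.
Qed.

Variable B : Z -> R.
Hypothesis fB : forall j z, `|f j z| <= B z.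

Lemma maxsum_le n w : maxsum n w <= \sum_(i < n) B (w i).
Proof.
have B0 z : 0 <= B z by exact: le_trans (normr_ge0 _) (fB 0 z).
apply: bigmax_le => [|j _]; first exact: sumr_ge0.
by apply: (le_trans (ler_norm_sum _ _ _)); exact: ler_sum.
Qed.

(** Cuts the path into past, one jump and future. At a first passage the past is still below the
    level, so the overshoot is at most one value of the envelope. *)
Lemma maxsumS k n w :
  maxsum (k.+1 + n) w <= maxsum k w + B (w k) + maxsum n (seqshift k.+1 w).
Proof.
apply: (le_trans (maxsumD _ _ _)); rewrite lerD2r -addn1.
apply: (le_trans (maxsumD _ _ _)); rewrite lerD2l.
by apply: (le_trans (maxsum_le _ _)); rewrite big_ord1 /seqshift addn0.
Qed.

End maxsum.

(** * First passages, Ottaviani's inequality and the restart argument *)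

Section exponential_moment.
Context {d} {Z : measurableType d} {R : realType}.
Variables (Q : probability Z R) (L : probability (seqspace Z) R).
Hypothesis iidL : iid_law Q L.
Variables (f : nat -> Z -> R) (B : Z -> R) (J : nat).
Hypothesis mf : forall j, measurable_fun setT (f j).
Hypothesis mB : measurable_fun setT B.
Hypothesis fB : forall j z, `|f j z| <= B z.

Local Notation N := (maxsum f J).

(* First passage above level [c] at time [k.+1]. *)
Definition passage (c : R) k : set (seqspace Z) :=
  [set w | (forall i, (i <= k)%N -> N i w <= c) /\ c < N k.+1 w].

Lemma measurable_passage c k : measurable (passage c k).
Proof.
have -> : passage c k = (\bigcap_(i in [set i | (i <= k)%N]) [set w | N i w <= c]) `&`
    [set w | c < N k.+1 w] by [].
apply: measurableI; last first.
  by apply: measurable_set_lt => //; exact: measurable_maxsum.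
apply: bigcap_measurableType => i _.
by apply: measurable_set_le => //; exact: measurable_maxsum.
Qed.

(** A first passage time is a stopping time; this is adaptedness in the form required by
    [integral_split]. *)
Lemma passage_seqcat c k x : (\1_(passage c k) (seqcat k.+1 x) : R) = \1_(passage c k) x.1.
Proof.
rewrite !indicE; congr (_%:R); congr nat_of_bool; apply/idP/idP; rewrite !inE /passage /=.
- move=> [h1 h2]; split; last by rewrite maxsum_seqcat in h2.
  by move=> i ik; have := h1 _ ik; rewrite maxsum_seqcat// (leq_trans ik).
- move=> [h1 h2]; split; last by rewrite maxsum_seqcat.
  by move=> i ik; have := h1 _ ik; rewrite maxsum_seqcat// (leq_trans ik).
Qed.

Lemma trivIset_passage c : trivIset setT (passage c).
Proof.
apply/trivIsetP => i j _ _.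
wlog ij : i j / (i < j)%N.
  move=> h; case: (ltngtP i j) => //; first by move=> ij _; apply: h => //; rewrite ltn_eqF.
  by move=> ji _; rewrite setIC; apply: h => //; rewrite ltn_eqF.
move=> _; apply/seteqP; split => w //= -[[_ h] [/(_ i.+1 ij) h' _]].
by rewrite ltNge h' in h.
Qed.

Local Open Scope ereal_scope.

(** After a passage above [b + b], the independent remainder stays below [b] with probability at
    least 1/2, and then the sum at time n still exceeds [b]. These events are disjoint in k, so the
    passage probabilities add up to at most twice [L (b < N n)]. *)
Lemma ottaviani n (b e : R) : (0 <= b)%R -> (e <= 2^-1)%R ->
  (forall j, (j <= n)%N -> L [set w | b < N j w]%R <= e%:E) ->
  \sum_(k < n) L (passage (b + b) k) <= (e + e)%:E.
Proof.
move=> b0 e2 Le.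
pose G k : set (seqspace Z) := [set w | N (n - k.+1) w <= b]%R.
have mG k : measurable (G k) by apply: measurable_set_le => //; exact: measurable_maxsum.
have mbN j : measurable [set w : seqspace Z | b < N j w]%R.
  by apply: measurable_set_lt => //; exact: measurable_maxsum.
have LG k : (2^-1)%:E <= L (G k).
  have -> : G k = ~` [set w | b < N (n - k.+1) w]%R.
    by rewrite /G; apply/seteqP; split => w /=; rewrite leNgt => /negP.
  rewrite probability_setC//.
  have /fineK <- : L [set w | b < N (n - k.+1) w]%R \is a fin_num by exact: fin_num_measure.
  have := Le (n - k.+1)%N (leq_subr _ _).
  have /fineK <- : L [set w | b < N (n - k.+1) w]%R \is a fin_num by exact: fin_num_measure.
  by rewrite -EFinB !lee_fin; lra.
pose E k := passage (b + b) k `&` (seqshift k.+1 : seqspace Z -> seqspace Z) @^-1` G k.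
have mE k : measurable (E k).
  apply: measurableI; first exact: measurable_passage.
  rewrite -[X in measurable X]setTI; exact: measurable_seqshift.
have LE k : L (E k) = L (passage (b + b) k) * L (G k).
  have LI (A : set (seqspace Z)) : measurable A -> L A = \int[L]_w (\1_A w)%:E.
    by move=> mA; rewrite integral_indic// setIT.
  rewrite (LI (E k))// (LI (G k))// (LI (passage _ _)); last exact: measurable_passage.
  rewrite -(integral_split _ _ iidL k.+1)//.
  - apply: eq_integral => w _.
    by rewrite -EFinM /E indicI /= !indicE.
  - by apply/measurable_EFinP; apply: measurable_indic; exact: measurable_passage.
  - by apply/measurable_EFinP; apply: measurable_indic.
  - by move=> x; rewrite passage_seqcat.
have tE : trivIset setT E.
  apply/trivIsetP => i j _ _ ij; apply/seteqP; split => w //= -[[Ei _] [Ej _]].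
  suff : (@set0 (seqspace Z)) w by [].
  by have /trivIsetP/(_ i j Logic.I Logic.I ij) <- := trivIset_passage (b + b)%R.
have : \sum_(k < n) L (E k) <= e%:E.
  rewrite -measure_bigsetU//; apply: le_trans (Le n (leqnn n)).
  apply: le_measure; rewrite ?inE//; first exact: bigsetU_measurable.
  rewrite -bigcup_mkord => w [k /= kn [[_ bN]]] /=; rewrite /G /= => Nb.
  rewrite ltNge; apply/negP => Nn.
  have := maxsum_le_shift f J k.+1 (n - k.+1) w; rewrite subnKC// => h.
  by move: bN; rewrite ltNge => /negP; apply; apply: (le_trans h); exact: lerD.
move=> le_e; have -> : (e + e)%:E = 2%:E * e%:E by rewrite -EFinM; congr EFin; lra.
rewrite muleC -lee_pdivrMr//; apply: le_trans le_e.
rewrite ge0_sume_distrl//; apply: lee_sum => k _.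
by rewrite LE; apply: lee_pmul.
Qed.

(** The summand 1 covers the paths that end below [b + b]. On any other path one term of the sum,
    that of the first passage, already dominates: past below the level, one jump, and a fresh start
    over the remaining horizon. *)
Lemma exp_maxsum_decomp n (b lam : R) w : (0 <= b)%R -> (0 <= lam)%R ->
  (expR (lam * N n w) <= expR (lam * (b + b)) *
    (1 + \sum_(k < n) \1_(passage (b + b) k) w * expR (lam * B (w k)) *
           expR (lam * N (n - k.+1) (seqshift k.+1 w))))%R.
Proof.
move=> b0 lam0.
have s0 : (0 <= \sum_(k < n) \1_(passage (b + b) k) w * expR (lam * B (w k)) *
           expR (lam * N (n - k.+1) (seqshift k.+1 w)))%R.
  by apply: sumr_ge0 => k _; rewrite !mulr_ge0 ?expR_ge0.
have [Nb|Nb] := leP (N n w) (b + b)%R.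
  rewrite -[leLHS]mulr1 ler_pM ?expR_ge0 ?ler_expR ?ler_wpM2l//.
  by rewrite lerDl.
have [k kP kmin] : exists2 k, (b + b < N k w)%R & forall i, (i < k)%N -> (N i w <= b + b)%R.
  have ex : exists k, (b + b < N k w)%R by exists n.
  exists (ex_minn ex); first by case: ex_minnP.
  move=> i; case: ex_minnP => m _ hm im; rewrite leNgt; apply/negP => /hm.
  by rewrite leqNgt im.
have kn : (k <= n)%N.
  by rewrite leqNgt; apply/negP => nk; move: (kmin n nk); rewrite leNgt Nb.
case: k kP kmin kn => [|k] kP kmin kn.
  by move: kP; rewrite maxsum0 ltNge addr_ge0.
have pk : (\1_(passage (b + b) k) w = 1 :> R)%R by rewrite indicE mem_set.
apply: (@le_trans _ _ (expR (lam * (b + b)) *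
  (expR (lam * B (w k)) * expR (lam * N (n - k.+1) (seqshift k.+1 w)))))%R.
  rewrite -!expRD ler_expR -!mulrDr ler_wpM2l//.
  have := maxsumS f J B fB k (n - k.+1)%N w; rewrite subnKC// => h.
  by apply: (le_trans h); rewrite addrA !lerD2r; exact: kmin.
rewrite ler_wpM2l ?expR_ge0// (bigD1 (Ordinal kn))//= pk mul1r.
rewrite addrCA lerDl addr_ge0//; apply: sumr_ge0 => i _.
by rewrite !mulr_ge0 ?expR_ge0.
Qed.

(* Restarting after the first passage bounds the moment at horizon [j] by moments at
   smaller horizons, whence the strong induction; no a priori finiteness is needed. *)
Lemma exp_maxsum_le4 n (b e lam rho : R) (Psi : Z -> R) :
  (0 <= b)%R -> (e <= 2^-1)%R -> (0 <= lam)%R -> (0 <= rho)%R ->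
  (expR (lam * (b + b)) <= 2)%R ->
  measurable_fun setT Psi -> (forall z, 0 <= Psi z)%R ->
  (forall z, expR (lam * B z) <= rho + Psi z)%R ->
  (rho * (e + e))%:E + n%:R%:E * \int[Q]_z (Psi z)%:E <= (4^-1)%:E ->
  (forall j, (j <= n)%N -> L [set w | b < N j w]%R <= e%:E) ->
  forall j, (j <= n)%N -> \int[L]_w (expR (lam * N j w))%:E <= 4%:E.
Proof.
move=> b0 e2 lam0 rho0 lamb mPsi Psi0 BPsi small Le.
have mexpN j : measurable_fun setT (fun w : seqspace Z => expR (lam * N j w)).
  apply: measurableT_comp => //; apply: measurable_funM => //.
  exact: measurable_maxsum.
have mexpB k : measurable_fun setT (fun w : seqspace Z => expR (lam * B (w k))).
  apply: measurableT_comp => //; apply: measurable_funM => //.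
  exact: measurableT_comp mB (measurable_coord k).
elim/ltn_ind => j IH jn.
pose F k (w : seqspace Z) : \bar R :=
  (\1_(passage (b + b) k) w * expR (lam * B (w k)))%:E.
pose H k (w : seqspace Z) : \bar R := (expR (lam * N (j - k.+1) w))%:E.
have mH k : measurable_fun setT (H k) by apply/measurable_EFinP.
have mF k : measurable_fun setT (F k).
  apply/measurable_EFinP; apply: measurable_funM => //.
  by apply: measurable_indic; exact: measurable_passage.
have F0 k w : 0 <= F k w by rewrite lee_fin mulr_ge0 ?expR_ge0.
have H0 k w : 0 <= H k w by rewrite lee_fin expR_ge0.
have mFH k : measurable_fun setT (fun w => F k w * H k (seqshift k.+1 w)).
  exact: emeasurable_funM (mF k) (measurableT_comp (mH k) (measurable_seqshift k.+1)).
apply: (@le_trans _ _ (\int[L]_w ((expR (lam * (b + b)))%:E *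
    (1 + \sum_(k < j) F k w * H k (seqshift k.+1 w))))).
  apply: ge0_le_integral => //.
  - exact/measurable_EFinP.
  - apply: emeasurable_funM => //; apply: emeasurable_funD => //.
    exact: emeasurable_sum.
  - move=> w _; have := exp_maxsum_decomp j b lam w b0 lam0.
    by rewrite -lee_fin EFinM EFinD -sumEFin.
rewrite ge0_integralZl//; last 2 first.
- by apply: emeasurable_funD => //; exact: emeasurable_sum.
- by move=> w _; apply: adde_ge0 => //; apply: sume_ge0 => k _; exact: mule_ge0.
rewrite ge0_integralD//; last 2 first.
- by move=> w _; apply: sume_ge0 => k _; exact: mule_ge0.
- exact: emeasurable_sum.
rewrite integral_cst// mul1e ge0_integral_sum//; last first.
  by move=> k w _; exact: mule_ge0.
rewrite (_ : _ setT = 1); last exact: probability_setT.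
(* The jump factor is split as [rho + Psi]: the bounded part is weighted by the passage
   probabilities, controlled by [ottaviani], and the tail part is simply summed over all steps. *)
have FS : \sum_(k < j) \int[L]_w F k w <= (4^-1)%:E.
  apply: le_trans small.
  apply: (@le_trans _ _ (\sum_(k < j) (rho%:E * L (passage (b + b) k) + \int[Q]_z (Psi z)%:E))).
    apply: lee_sum => k _.
    rewrite -(integral_coord _ _ iidL k)//; last exact/measurable_EFinP.
    have mp : measurable (passage (b + b) k) by exact: measurable_passage.
    rewrite -[X in L X]setIT -integral_indic// -ge0_integralZl_EFin//; last first.
      by apply/measurable_EFinP; exact: measurable_indic.
    have mPsik : measurable_fun setT (fun w : seqspace Z => (Psi (w k))%:E).
      by apply/measurable_EFinP; exact: measurableT_comp mPsi (measurable_coord k).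
    have mrp : measurable_fun setT (fun w : seqspace Z => rho%:E * (\1_(passage (b + b) k) w)%:E).
      by apply: emeasurable_funM => //; apply/measurable_EFinP; exact: measurable_indic.
    have rp0 (w : seqspace Z) : setT w -> 0 <= rho%:E * (\1_(passage (b + b) k) w)%:E.
      by move=> _; exact: mule_ge0.
    rewrite -ge0_integralD//; last by move=> w _; rewrite lee_fin.
    apply: ge0_le_integral => //.
    - exact: emeasurable_funD.
    - move=> w _; rewrite -EFinM -EFinD lee_fin indicE.
      case: (_ \in _); rewrite ?mul1r ?mulr1; first exact: BPsi.
      by rewrite mul0r mulr0 add0r.
  rewrite big_split /= -ge0_sume_distrr//; apply: leeD.
    rewrite EFinM; apply: lee_wpmul2l => //.
    by apply: ottaviani => // i ij; apply: Le; exact: leq_trans ij jn.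
  have I0 : 0 <= \int[Q]_z (Psi z)%:E by apply: integral_ge0 => z _; rewrite lee_fin.
  rewrite sume_const_ord//; apply: lee_wpmul2r => //.
  by rewrite lee_fin ler_nat.
(* The induction closes because 4 is a fixed point: [2 * (1 + 4 / 4) = 4]. *)
apply: (@le_trans _ _ (2%:E * (1%:E + (4^-1)%:E * 4%:E))); last first.
  rewrite -[X in _ * (_ + X)]EFinM -[X in _ * X]EFinD -EFinM lee_fin; lra.
apply: lee_pmul.
- by rewrite lee_fin expR_ge0.
- apply: adde_ge0 => //; apply: sume_ge0 => k _.
  by apply: integral_ge0 => w _; exact: mule_ge0.
- by rewrite lee_fin.
- apply: leeD => //.
  apply: (@le_trans _ _ (\sum_(k < j) (\int[L]_w F k w * 4%:E))).
    apply: lee_sum => k _; rewrite (integral_split _ _ iidL k.+1)//; last first.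
      move=> x; rewrite /F passage_seqcat; congr (_ * expR (_ * B _))%:E.
      by rewrite /seqcat ltnSn.
    apply: lee_wpmul2l; first exact: integral_ge0.
    apply: IH; first by rewrite ltn_subrL /= (leq_ltn_trans _ (ltn_ord k)).
    exact: leq_trans (leq_subr _ _) jn.
  rewrite -ge0_sume_distrl; last by move=> k _; exact: integral_ge0.
  exact: lee_wpmul2r.
Qed.

(** Subadditivity and independence make the moment submultiplicative over blocks. The last block may
    be shorter than m, hence the hypothesis at every horizon up to m. *)
Lemma exp_maxsum_blocks m lam : (0 <= lam)%R ->
  (forall j, (j <= m)%N -> \int[L]_w (expR (lam * N j w))%:E <= 4%:E) ->
  forall k n, (n <= m * k)%N -> \int[L]_w (expR (lam * N n w))%:E <= (4 ^+ k)%:E.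
Proof.
move=> lam0 h.
have mexpN j : measurable_fun setT (fun w : seqspace Z => expR (lam * N j w)).
  apply: measurableT_comp => //; apply: measurable_funM => //.
  exact: measurable_maxsum.
have mEexpN j : measurable_fun setT (fun w : seqspace Z => (expR (lam * N j w))%:E).
  exact/measurable_EFinP.
elim => [n|k IH n nmk].
  rewrite muln0 leqn0 => /eqP ->.
  under eq_integral do rewrite maxsum0 mulr0 expR0.
  by rewrite integral_cst// mul1e (_ : _ setT = 1)//; exact: probability_setT.
have [nm|mn] := leqP n m.
  apply: (le_trans (h _ nm)); rewrite lee_fin exprS ler_peMr// exprn_ege1//.
  by rewrite ler1n.
apply: (@le_trans _ _ (\int[L]_w ((expR (lam * N m w))%:E *
    (expR (lam * N (n - m) (seqshift m w)))%:E))).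
  apply: ge0_le_integral => //.
  - apply: emeasurable_funM => //.
    exact: measurableT_comp (mEexpN (n - m)%N) (measurable_seqshift m).
  - move=> w _; rewrite -EFinM lee_fin -expRD ler_expR -mulrDr ler_wpM2l//.
    by have := maxsumD f J m (n - m) w; rewrite subnKC// ltnW.
rewrite (integral_split _ _ iidL m _ (fun w => (expR (lam * N (n - m) w))%:E))//.
- rewrite exprS EFinM; apply: lee_pmul.
  + by apply: integral_ge0 => w _; rewrite lee_fin expR_ge0.
  + by apply: integral_ge0 => w _; rewrite lee_fin expR_ge0.
  + exact: h.
  + by apply: IH; rewrite leq_subLR -mulnS.
- by move=> x; rewrite maxsum_seqcat.
Qed.

End exponential_moment.

(** * Moderate deviations *)

Section moderate_deviation.
Context {d} {Z : measurableType d} {R : realType}.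
Variables (Q : probability Z R) (L : probability (seqspace Z) R).
Hypothesis iidL : iid_law Q L.
Variables (f : nat -> Z -> R) (B : Z -> R).
Hypothesis mf : forall j, measurable_fun setT (f j).
Hypothesis mB : measurable_fun setT B.
Hypothesis fB : forall j z, `|f j z| <= B z.
Variable a : R.
Hypothesis a0 : 0 < a.
Hypothesis expB : (\int[Q]_z (expR (a * B z))%:E < +oo)%E.
Hypothesis tightN : forall e, 0 < e -> exists2 M, 0 <= M & forall J n,
  (L [set w | M * Num.sqrt n%:R < maxsum f J n w]%R <= e%:E)%E.

(** If the exponent exceeds [r], then [y = a x / 2] satisfies [y >= r sqrt m], so
    [1 <= y^2 / (m r^2) <= 2 e^y / (m r^2)]. The other half of [e^(a x)] bounds the left-hand side.
    The factor [1 / m] offsets the number of steps in a block. *)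
Lemma exp_envelope_split (lam0 r x m : R) : 0 <= lam0 -> lam0 <= a / 2 ->
  0 < r -> 0 <= x -> 1 <= m ->
  expR (lam0 / Num.sqrt m * x) <= expR r + 2 / (m * r ^+ 2) * expR (a * x).
Proof.
move=> l0 l0a r0 x0 m1.
have m0 : 0 < m by exact: lt_le_trans m1.
have sm0 : 0 < Num.sqrt m by rewrite sqrtr_gt0.
have sm1 : 1 <= Num.sqrt m by rewrite -sqrtr1 ler_wsqrtr.
have K0 : 0 <= 2 / (m * r ^+ 2) * expR (a * x).
  by rewrite mulr_ge0 ?expR_ge0// divr_ge0// mulr_ge0 ?sqr_ge0// ltW.
have [xr|rx] := leP (lam0 / Num.sqrt m * x) r.
  by apply: ler_wpDr => //; rewrite ler_expR.
apply: ler_wpDl; first exact: expR_ge0.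
pose y := a / 2 * x.
have y0 : 0 <= y by rewrite mulr_ge0// divr_ge0// ltW.
have xy : lam0 * x <= y by rewrite ler_wpM2r.
have ry : r * Num.sqrt m <= y.
  apply: le_trans xy; rewrite -ler_pdivlMr//.
  by apply: ltW; rewrite mulrAC in rx.
have -> : a * x = y + y by rewrite /y; lra.
rewrite expRD mulrA; apply: (@le_trans _ _ (expR y)).
  rewrite ler_expR; apply: le_trans xy; apply: ler_wpM2r => //.
  by rewrite ler_pdivrMr// ler_peMr.
rewrite -[leLHS]mul1r ler_wpM2r ?expR_ge0//.
have my : m * r ^+ 2 <= y ^+ 2.
  have -> : m * r ^+ 2 = (r * Num.sqrt m) ^+ 2 by rewrite exprMn sqr_sqrtr ?ltW// mulrC.
  by rewrite ler_sqr ?nnegrE// mulr_ge0// ltW.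
rewrite mulrAC ler_pdivlMr ?mulr_gt0 ?exprn_gt0// mul1r.
apply: (le_trans my).
have := @expR_ge1Dxn R y 1 y0; rewrite (_ : 2`! = 2%N)//; lra.
Qed.

Lemma exp_moment_bounded : exists2 lam0, 0 < lam0 &
  forall J m, (0 < m)%N -> forall j, (j <= m)%N ->
  (\int[L]_w (expR (lam0 / Num.sqrt m%:R * maxsum f J j w))%:E <= 4%:E)%E.
Proof.
have B0 z : 0 <= B z by exact: le_trans (normr_ge0 _) (fB 0 z).
have mexpB : measurable_fun setT (fun z => expR (a * B z)).
  by apply: measurableT_comp => //; apply: measurable_funM.
pose C := fine (\int[Q]_z (expR (a * B z))%:E).
have CE : (\int[Q]_z (expR (a * B z))%:E)%E = C%:E.
  by rewrite fineK// ge0_fin_numE//; apply: integral_ge0 => z _; rewrite lee_fin expR_ge0.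
have C0 : 0 <= C.
  by rewrite fine_ge0//; apply: integral_ge0 => z _; rewrite lee_fin expR_ge0.
(* The budget 1/4 of [exp_maxsum_le4] is split in two: [r] makes the tail term [2 C / r^2] at most
   1/8, and [e] below makes [expR r * (e + e)] equal to 1/8. *)
pose r := 4 * (C + 1).
have r0 : 0 < r by rewrite /r; lra.
pose e := expR (- r) / 16.
have e0 : 0 < e by rewrite divr_gt0// expR_gt0.
have e2 : e <= 2^-1.
  have : expR (- r) <= 1 by rewrite -expR0 ler_expR; lra.
  by rewrite /e; lra.
have [M M0 HM] := tightN e e0.
have ln20 : 0 < ln 2 :> R by rewrite ln_gt0// ltr1n.
(* The first bound serves [exp_envelope_split]; the second gives [expR (lam * (b + b)) <= 2] at
   [b = M sqrt m]. Writing [M + 1] keeps the denominator positive when M is 0. *)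
pose lam0 := Num.min (a / 2) (ln 2 / (2 * (M + 1))).
have den0 : 0 < 2 * (M + 1) by lra.
have lam0_gt0 : 0 < lam0 by rewrite lt_min !divr_gt0.
have lam0a : lam0 <= a / 2 by rewrite ge_min lexx.
have lam0M : lam0 * (M + M) <= ln 2.
  apply: (@le_trans _ _ (ln 2 / (2 * (M + 1)) * (2 * (M + 1)))); last by rewrite divfK// gt_eqF.
  apply: ler_pM; [exact: ltW|lra| |lra].
  by rewrite ge_min lexx orbT.
exists lam0 => // J m m0.
have m1 : 1 <= m%:R :> R by rewrite ler1n.
have m0R : 0 < m%:R :> R by rewrite ltr0n.
have sm0 : 0 < Num.sqrt m%:R :> R by rewrite sqrtr_gt0.
pose q : R := 2 / (m%:R * r ^+ 2).
have q0 : 0 <= q by rewrite divr_ge0// mulr_ge0 ?sqr_ge0// ltW.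
apply: (exp_maxsum_le4 _ _ iidL f B J mf mB fB m (M * Num.sqrt m%:R) e _ (expR r)
  (fun z => q * expR (a * B z))) => //.
- by rewrite mulr_ge0// sqrtr_ge0.
- by rewrite divr_ge0 ?sqrtr_ge0// ltW.
- have -> : lam0 / Num.sqrt m%:R * (M * Num.sqrt m%:R + M * Num.sqrt m%:R) = lam0 * (M + M).
    rewrite -mulrDl -mulrA; congr (_ * _).
    by rewrite mulrC mulfK// gt_eqF.
  by rewrite -[leRHS]lnK ?posrE// ler_expR.
- exact: measurable_funM.
- by move=> z; rewrite mulr_ge0 ?expR_ge0.
- by move=> z; apply: exp_envelope_split => //; exact: ltW.
- under eq_integral do rewrite EFinM.
  rewrite ge0_integralZl_EFin//; last exact/measurable_EFinP.
  rewrite CE (_ : q%:E * C%:E = (q * C)%:E)%E// -EFinM -EFinD lee_fin.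
  have -> : expR r * (e + e) = 8^-1.
    have : expR r * expR (- r) = 1 by rewrite -expRD subrr expR0.
    by rewrite /e => h; rewrite -mulrDl mulrA mulrDr h; lra.
  have -> : m%:R * (q * C) = 2 * C / r ^+ 2.
    by rewrite /q; field; rewrite !gt_eqF.
  have : 2 * C / r ^+ 2 <= 8^-1.
    rewrite ler_pdivrMr ?exprn_gt0// /r; nra.
  lra.
- move=> j jm; apply: le_trans (HM J j).
  apply: le_measure; rewrite ?inE; try by apply: measurable_set_lt => //; exact: measurable_maxsum.
  move=> w /=; apply: le_lt_trans; apply: ler_wpM2l => //.
  by rewrite ler_wsqrtr// ler_nat.
Qed.

Lemma moderate_deviation (v : nat -> R) (t : R) : 0 < t ->
  v n @[n --> \oo] --> +oo -> v n / n%:R @[n --> \oo] --> 0 ->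
  exists2 c, 0 < c & \forall n \near \oo, forall J,
    (L [set w | t * Num.sqrt (n%:R * v n) < maxsum f J n w]%R <= (expR (- c * v n))%:E)%E.
Proof.
move=> t0 voo vn0.
have [lam0 lam0_gt0 H4] := exp_moment_bounded.
(* With this choice the Markov gain is at least [lam0 t s v_n = 16 s^2 v_n], while the blocks cost
   [4^k <= expR (8 s^2 v_n)]. Half of the gain survives. *)
pose s := lam0 * t / 16.
have s0 : 0 < s by rewrite divr_gt0// mulr_gt0.
have s20 : 0 < s ^+ 2 by rewrite exprn_gt0.
exists (lam0 * t * s / 2); first by rewrite divr_gt0// !mulr_gt0.
(* These two eventual bounds absorb the roundings: k stays within a factor 2 of [2 s^2 v_n], and
   [k <= n] ensures [m k <= 2 n]. *)
have ev1 : \forall n \near \oo, 1 <= 2 * s ^+ 2 * v n.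
  move/cvgryPge : voo => /(_ ((2 * s ^+ 2)^-1)); apply: filterS => n.
  by rewrite -[_^-1]mul1r ler_pdivrMr ?mulr_gt0// mulrC.
have ev2 : \forall n \near \oo, 4 * s ^+ 2 * v n <= n%:R.
  have /cvgrPdist_le /(_ ((4 * s ^+ 2)^-1)) := vn0.
  rewrite invr_gt0 mulr_gt0// => /(_ isT).
  move=> h; near=> n.
  have n0 : 0 < n%:R :> R by rewrite ltr0n; near: n; exact: nbhs_infty_gt.
  have : `|0 - v n / n%:R| <= (4 * s ^+ 2)^-1 by near: n.
  rewrite sub0r normrN => /(le_trans (ler_norm _)).
  by rewrite ler_pdivrMr// ler_pdivlMl ?mulr_gt0.
near=> n => J.
have h1 : 1 <= 2 * s ^+ 2 * v n by near: n.
have h2 : 4 * s ^+ 2 * v n <= n%:R by near: n.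
have v0 : 0 < v n.
  have : 0 < 2 * s ^+ 2 * v n by lra.
  by rewrite pmulr_rgt0// mulr_gt0.
pose k := (Num.truncn (2 * s ^+ 2 * v n)).+1.
have k1 : 2 * s ^+ 2 * v n <= k%:R by apply: ltW; exact: truncnS_gt.
have k2 : k%:R <= 4 * s ^+ 2 * v n.
  rewrite /k -natr1.
  have : (Num.truncn (2 * s ^+ 2 * v n))%:R <= 2 * s ^+ 2 * v n by rewrite truncn_le; lra.
  by lra.
have kn : (k <= n)%N by rewrite -(ler_nat R); exact: le_trans k2 h2.
pose m := (n %/ k).+1.
have nmk : (n <= m * k)%N by rewrite /m mulSn [in leqLHS](divn_eq n k) addnC leq_add2r ltnW// ltn_pmod.
have mk2n : (m * k)%:R <= 2 * n%:R :> R.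
  rewrite -natrM ler_nat /m mulSn mul2n -addnn leq_add// leq_trunc_div//.
have smv : s * v n * Num.sqrt m%:R <= Num.sqrt (n%:R * v n).
  have sv0 : 0 <= s * v n by rewrite mulr_ge0// ltW.
  rewrite -[s * v n]ger0_norm// -sqrtr_sqr -sqrtrM ?sqr_ge0//.
  apply: ler_wsqrtr.
  have -> : (s * v n) ^+ 2 * m%:R = (s ^+ 2 * v n * m%:R) * v n by ring.
  apply: ler_wpM2r; first exact: ltW.
  have : 2 * s ^+ 2 * v n * m%:R <= k%:R * m%:R by apply: ler_wpM2r.
  by move: mk2n; rewrite natrM; lra.
pose lam := lam0 / Num.sqrt m%:R.
have sm0 : 0 < Num.sqrt m%:R :> R by rewrite sqrtr_gt0 ltr0n.
have lam_gt0 : 0 < lam by rewrite divr_gt0.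
have Hk : (\int[L]_w (expR (lam * maxsum f J n w))%:E <= (4 ^+ k)%:E)%E.
  apply: (exp_maxsum_blocks _ _ iidL f J mf m) => //; first exact: ltW.
  exact: H4.
set T := t * Num.sqrt (n%:R * v n).
have mexpN : measurable_fun setT (fun w : seqspace Z => expR (lam * maxsum f J n w)).
  apply: measurableT_comp => //; apply: measurable_funM => //.
  exact: measurable_maxsum.
have := markov_lt L _ (expR (lam * T)) mexpN (fun=> expR_ge0 _) (expR_ge0 _).
rewrite (_ : [set x | _] = [set w | T < maxsum f J n w]); last first.
  by apply/seteqP; split => w /=; rewrite ltr_expR ltr_pM2l.
move=> /le_trans /(_ Hk); rewrite -lee_pdivlMl ?expR_gt0// => /le_trans; apply.
rewrite -expRN -EFinM lee_fin.
have lamT : lam0 * t * s * v n <= lam * T.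
  have -> : lam * T = lam0 * t * (Num.sqrt (n%:R * v n) / Num.sqrt m%:R).
    by rewrite /lam /T; field; rewrite gt_eqF.
  have -> : lam0 * t * s * v n = lam0 * t * (s * v n) by ring.
  apply: ler_wpM2l; first by rewrite mulr_ge0// ltW.
  by rewrite ler_pdivlMr.
have : 4 ^+ k <= expR (8 * s ^+ 2 * v n).
  have e4 : 4 <= expR 2 :> R.
    have -> : 2 = 1 + 1 :> R by lra.
    rewrite expRD; have := @expR_ge1Dx R 1; nra.
  apply: (@le_trans _ _ (expR 2 ^+ k)); first by rewrite lerXn2r// nnegrE// expR_ge0.
  rewrite -expRM_natl ler_expR; lra.
move=> h; apply: (@le_trans _ _ (expR (- (lam * T)) * expR (8 * s ^+ 2 * v n))).
  by rewrite ler_wpM2l ?expR_ge0.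
rewrite -expRD ler_expR.
have : 8 * s ^+ 2 = lam0 * t * s / 2 by rewrite /s expr2; lra.
move=> ->; lra.
Unshelve. all: by end_near. Qed.

End moderate_deviation.

(** * Tightness *)

Section tightness.
Context {d} {Z : measurableType d} {R : realType}.
Variables (Q : probability Z R) (L : probability (seqspace Z) R).
Hypothesis iidL : iid_law Q L.
Variables (f : nat -> Z -> R) (B : Z -> R).
Hypothesis mf : forall j, measurable_fun setT (f j).
Hypothesis mB : measurable_fun setT B.
Hypothesis fB : forall j z, `|f j z| <= B z.

Lemma integral_maxsum_le J n :
  (\int[L]_w (maxsum f J n w)%:E <= n%:R%:E * \int[Q]_z (B z)%:E)%E.
Proof.
have B0 z : 0 <= B z by exact: le_trans (normr_ge0 _) (fB 0 z).
have mBi i : measurable_fun setT (fun w : seqspace Z => (B (w i))%:E).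
  by apply/measurable_EFinP; exact: measurableT_comp mB (measurable_coord i).
apply: (@le_trans _ _ (\int[L]_w \sum_(i < n) (B (w i))%:E)%E).
  apply: ge0_le_integral => //.
  - by move=> w _; rewrite lee_fin maxsum_ge0.
  - by apply/measurable_EFinP; exact: measurable_maxsum.
  - exact: emeasurable_sum.
  - by move=> w _; rewrite sumEFin lee_fin; exact: maxsum_le.
rewrite ge0_integral_sum//; last by move=> i w _; rewrite lee_fin.
have coordB i : (\int[L]_w (B (w i))%:E = \int[Q]_z (B z)%:E)%E.
  by apply: (integral_coord _ _ iidL i (EFin \o B)) => //; exact/measurable_EFinP.
under eq_bigr do rewrite coordB.
rewrite sume_const_ord//.
by apply: integral_ge0 => z _; rewrite lee_fin.
Qed.

(** Weak convergence controls only large n, whereas the restart needs every horizon. Below [N0],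
    Markov's inequality with the integrable envelope suffices, and it is uniform in J. *)
Lemma tight_maxsum : (\int[Q]_z (B z)%:E < +oo)%E ->
  (forall e, 0 < e -> exists M N0, forall J n, (N0 <= n)%N ->
    (L [set w | M * Num.sqrt n%:R < maxsum f J n w]%R <= e%:E)%E) ->
  forall e, 0 < e -> exists2 M, 0 <= M & forall J n,
    (L [set w | M * Num.sqrt n%:R < maxsum f J n w]%R <= e%:E)%E.
Proof.
move=> Boo ev e e0; have [M [N0 HM]] := ev e e0.
have B0 z : 0 <= B z by exact: le_trans (normr_ge0 _) (fB 0 z).
have IB0 : (0 <= \int[Q]_z (B z)%:E)%E by apply: integral_ge0 => z _; rewrite lee_fin.
pose b := fine (\int[Q]_z (B z)%:E).
have bE : (\int[Q]_z (B z)%:E)%E = b%:E by rewrite fineK// ge0_fin_numE.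
have b0 : 0 <= b by rewrite fine_ge0.
(* Markov's bound at [n < N0] is at most [N0 b / q], hence at most [e]; the added 1 keeps [q]
   positive. *)
pose q := (N0%:R * b + 1) / e.
have q0 : 0 < q by rewrite divr_gt0//; have := mulr_ge0 (ler0n R N0) b0; lra.
have mN J n (x : R) : measurable [set w : seqspace Z | x < maxsum f J n w].
  by apply: measurable_set_lt => //; exact: measurable_maxsum.
exists (Num.max M q); first by rewrite le_max (ltW q0) orbT.
move=> J n; have [N0n|nN0] := leqP N0 n.
  apply: le_trans (HM J n N0n); apply: le_measure; rewrite ?inE//.
  move=> w /=; apply: le_lt_trans; apply: ler_wpM2r; first exact: sqrtr_ge0.
  by rewrite le_max lexx.
case: n nN0 => [|n] nN0.
  rewrite (_ : mkset _ = set0) ?measure0 ?lee_fin ?ltW//.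
  by apply/seteqP; split => w //=; rewrite maxsum0 sqrtr0 mulr0 ltxx.
apply: (@le_trans _ _ (L [set w | q < maxsum f J n.+1 w])).
  apply: le_measure; rewrite ?inE//.
  move=> w /=; apply: le_lt_trans; rewrite -[leLHS]mulr1; apply: ler_pM => //.
  - exact: ltW.
  - by rewrite le_max lexx orbT.
  - by rewrite -[leLHS]sqrtr1 ler_wsqrtr// ler1n.
have := markov_lt L (maxsum f J n.+1) q (measurable_maxsum f J mf n.+1)
  (maxsum_ge0 f J n.+1) (ltW q0).
move=> /le_trans /(_ (integral_maxsum_le J n.+1)); rewrite bE -EFinM.
rewrite -lee_pdivlMl// => /le_trans; apply.
rewrite -EFinM lee_fin ler_pdivrMl// /q divfK ?gt_eqF//.
have : n.+1%:R * b <= N0%:R * b by rewrite ler_wpM2r// ler_nat ltnW.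
lra.
Qed.

End tightness.

(** * The supremum distance on bounded functionals of a class *)

Section linf_norm.
Context {R : realType} {T : Type}.
Variable F : set (T -> R).

Definition linf_norm (z : (T -> R) -> R) : R := linf_dist F z (fun=> 0).

Lemma linf_dist_ge z z' g : linf_mem F z -> linf_mem F z' -> F g ->
  `|z g - z' g| <= linf_dist F z z'.
Proof.
move=> [M hM] [M' hM'] Fg; apply: ub_le_sup; last by exists g.
exists (M + M') => _ [h Fh <-]; apply: (le_trans (ler_normB _ _)).
by apply: lerD; [exact: hM|exact: hM'].
Qed.

Lemma linf_mem0 : linf_mem F (fun=> 0).
Proof. by exists 0 => h _; rewrite normr0. Qed.

Lemma linf_dist_le z z' (x : R) : 0 <= x ->
  (forall g, F g -> `|z g - z' g| <= x) -> linf_dist F z z' <= x.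
Proof.
move=> x0 h; have [->|/set0P[g Fg]] := eqVneq F set0.
  by rewrite /linf_dist image_set0 sup0.
apply: ge_sup; first by exists `|z g - z' g|, g.
by move=> _ [k Fk <-]; exact: h.
Qed.

(** The real [sup] takes the default value 0 on empty or unbounded sets, so no boundedness
    assumption is needed. *)
Lemma linf_dist_ge0 z z' : 0 <= linf_dist F z z'.
Proof.
rewrite /linf_dist; set A := (X in sup X).
have [hA|hA] := pselect (has_sup A); last by rewrite sup_out.
have [[x Ax] ubA] := hA; apply: (@le_trans _ _ x); last exact: ub_le_sup.
by case: Ax => g _ <-.
Qed.

Lemma linf_norm_le z z' : linf_mem F z -> linf_mem F z' ->
  linf_norm z <= linf_norm z' + linf_dist F z z'.
Proof.
move=> hz hz'; apply: linf_dist_le; first by rewrite addr_ge0 ?linf_dist_ge0.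
move=> g Fg; rewrite subr0 -(subrK (z' g) (z g)) addrC.
apply: (le_trans (ler_normD _ _)); apply: lerD; last exact: linf_dist_ge.
by rewrite -[z' g]subr0; apply: (linf_dist_ge z' (fun=> 0)) => //; exact: linf_mem0.
Qed.

Lemma linf_distC z z' : linf_dist F z z' = linf_dist F z' z.
Proof.
by rewrite /linf_dist; congr sup; apply/seteqP; split => _ [g Fg <-]; exists g => //;
  rewrite distrC.
Qed.

Lemma linf_open_norm (r : R) : linf_open F [set z | linf_mem F z /\ linf_norm z < r].
Proof.
split; first by move=> z [].
move=> z [hz zr]; exists (r - linf_norm z); first by rewrite subr_gt0.
move=> z' hz' zz'; split => //; apply: (le_lt_trans (linf_norm_le _ z hz' hz)).
by rewrite linf_distC; lra.
Qed.

(** A 1-Lipschitz substitute for the indicator of a large norm: 0 up to norm M, and 1 from norm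
    [M + 1] on. *)
Definition linf_ramp (M : R) z : R := Num.min 1 (Num.max 0 (linf_norm z - M)).

Lemma linf_ramp_ge0 M z : 0 <= linf_ramp M z.
Proof. by rewrite /linf_ramp le_min ler01/= le_max lexx. Qed.

Lemma linf_ramp_le1 M z : linf_ramp M z <= 1.
Proof. by rewrite /linf_ramp ge_min lexx. Qed.

Lemma linf_ramp_continuous M : linf_bounded_continuous F (linf_ramp M).
Proof.
split; first by exists 1 => z; rewrite ger0_norm ?linf_ramp_ge0 ?linf_ramp_le1.
move=> z hz e e0; exists e => // z' hz' zz'; apply: le_lt_trans zz'.
have h1 := linf_norm_le z z' hz hz'; have h2 := linf_norm_le z' z hz' hz.
have := linf_dist_ge0 z z'; rewrite linf_distC in h2; rewrite ler_norml /linf_ramp.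
move: h1 h2; set x := linf_norm z; set y := linf_norm z'; set q := linf_dist _ _ _.
move=> h1 h2 q0.
case: (leP 0 (x - M)) => hx; case: (leP 0 (y - M)) => hy.
all: rewrite ?minr10.
all: rewrite ?(min_r ler01).
all: try case: (leP 1 (x - M)) => hx1; try case: (leP 1 (y - M)) => hy1.
all: apply/andP; split; lra.
Qed.

End linf_norm.

(** * Boundedness in probability from the Donsker property *)

Section donsker_tight.
Context {R : realType} {dO} {O : measurableType dO} {PO : probability O R}
  {d} {Z : measurableType d} {X : nat -> O -> Z} {Q : probability Z R}
  {F : set (Z -> R)}.

(** The limit has a finite, measurable norm, so its ramp has integral below [e] for some M, and weak
    convergence passes this on to the outer expectations. Quantifying over measurable [A] avoids any
    measurability claim on the supremum of the empirical process. *)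
Lemma donsker_tight : (forall n w, linf_mem F (emp_proc X Q n w)) ->
  donsker PO X Q F -> forall e, 0 < e -> exists M N0, forall n, (N0 <= n)%N ->
  forall A : set O, measurable A ->
    (forall w, A w -> exists2 g, F g & M < `|emp_proc X Q n w g|) ->
    (PO A <= e%:E)%E.
Proof.
move=> memX [d' [T' [P' [G [memG mG _ cvgG]]]]] e e0.
have mnorm : measurable_fun setT (fun w => linf_norm F (G w)).
  apply: (measurability _ (RGenInftyO.measurableE R)) => _ [_ [r ->] <-].
  rewrite setTI (_ : _ @^-1` _ = G @^-1` [set z | linf_mem F z /\ linf_norm F z < r]).
    by apply: mG; exact: linf_open_norm.
  by apply/seteqP; split => w /=; rewrite in_itv/=; [|case].
pose U (M : nat) := [set w | linf_norm F (G w) < M%:R].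
have mU M : measurable (U M) by exact: measurable_set_lt.
have UT : \bigcup_M U M = setT.
  rewrite -subTset => w _; exists (Num.truncn (linf_norm F (G w))).+1 => //.
  exact: truncnS_gt.
have : P' (U n) @[n --> \oo] --> P' (\bigcup_M U M).
  apply: nondecreasing_cvg_mu => //; first exact: bigcup_measurable.
  move=> m n mn; apply/subsetPset => w /lt_le_trans; apply.
  by rewrite ler_nat.
rewrite UT probability_setT => cvgU.
have [M HM] : exists M, ((1 - e / 2)%:E < P' (U M))%E.
  have : \forall n \near \oo, ((1 - e / 2)%:E < P' (U n))%E.
    apply: (cvgU [set x | ((1 - e / 2)%:E < x)%E]); apply: open_nbhs_nbhs; split; first exact: open_ereal_gt_ereal.
    by rewrite /= lte_fin; lra.
  by case=> M _ /(_ M (leqnn M)); exists M.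
have mramp : measurable_fun setT (fun w => linf_ramp F M%:R (G w)).
  apply: measurable_minr => //; apply: measurable_maxr => //.
  exact: measurable_funB.
have rampe : (\int[P']_w (linf_ramp F M%:R (G w))%:E < e%:E)%E.
  apply: (@le_lt_trans _ _ (\int[P']_w (\1_(~` U M) w)%:E)%E).
    apply: ge0_le_integral => //.
    - by move=> w _; rewrite lee_fin linf_ramp_ge0.
    - exact/measurable_EFinP.
    - by apply/measurable_EFinP; apply: measurable_indic; exact: measurableC.
    - move=> w _; rewrite lee_fin indicE; case: (boolP (w \in _)).
        by move=> _; exact: linf_ramp_le1.
      rewrite notin_setE /= => /contrapT UMw.
      by rewrite /linf_ramp max_l ?(min_r ler01)// subr_le0 ltW.
  rewrite (_ : integral _ _ _ = 1 - P' (U M))%E; last first.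
    by rewrite -probability_setC// integral_indic ?setIT//; exact: measurableC.
  have UMfin : P' (U M) \is a fin_num by exact: fin_num_measure.
  by move: HM; rewrite -(fineK UMfin) -EFinB !lte_fin; lra.
have : \forall n \near \oo,
    (outer_E PO (fun w => linf_ramp F M%:R (emp_proc X Q n w)) < e%:E)%E.
  apply: (cvgG _ (linf_ramp_continuous F M%:R) [set x | (x < e%:E)%E]).
  by apply: open_nbhs_nbhs; split; first exact: open_ereal_lt_ereal.
move=> [N0 _ HN0]; exists (M%:R + 1), N0 => n N0n A mA AX.
(* An outer expectation below [e] provides a measurable majorant [V] of the ramp with integral below
   [e]; on [A] the ramp is 1, so [V] dominates the indicator of [A]. *)
have /ereal_inf_lt[_ [V [mV VX] <-] Ve] := HN0 n N0n.
apply: (le_trans _ (ltW Ve)); rewrite -[X in PO X]setIT -integral_indic//.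
apply: ge0_le_integral => //.
- by apply/measurable_EFinP; exact: measurable_indic.
- exact/measurable_EFinP.
- move=> w _; rewrite lee_fin indicE; apply: le_trans (VX w).
  case: (boolP (w \in A)); last by move=> _; exact: linf_ramp_ge0.
  rewrite inE => /AX[g Fg Mg].
  have : `|emp_proc X Q n w g| <= linf_norm F (emp_proc X Q n w).
    rewrite -[emp_proc X Q n w g]subr0.
    by apply: (linf_dist_ge F _ (fun=> 0)) => //; exact: linf_mem0.
  move=> h; rewrite /linf_ramp le_min lexx /= le_max; apply/orP; right.
  by move: Mg h; lra.
Qed.

End donsker_tight.

(** * Densities, separability and Orlicz envelopes *)

(* Carries the proof [sf] so that the sigma-finite measure structure can be inferred. *)
Definition with_sigma_finite {R : realType} {d} {Z : measurableType d}
    (mu : {measure set Z -> \bar R}) (sf : sigma_finite setT mu) : set Z -> \bar R := mu.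

Section with_sigma_finite_instance.
Context {R : realType} {d} {Z : measurableType d} (mu : {measure set Z -> \bar R})
  (sf : sigma_finite setT mu).

HB.instance Definition _ := Measure.copy (with_sigma_finite mu sf) mu.
HB.instance Definition _ := Measure_isSigmaFinite.Build _ _ _ (with_sigma_finite mu sf) sf.

End with_sigma_finite_instance.

(** * Densities and the equality case of Gibbs' inequality *)

Section density.
Context {R : realType} {d} {Z : measurableType d} (mu : {measure set Z -> \bar R})
  (P : probability Z R) (p : Z -> R).
Hypothesis sfmu : sigma_finite setT mu.
Hypothesis mp : measurable_fun setT p.
Hypothesis p0 : forall z, 0 <= p z.
Hypothesis Pp : forall A, measurable A -> P A = (\int[mu]_(x in A) (p x)%:E)%E.

Lemma density_integrable : mu.-integrable setT (EFin \o p).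
Proof.
apply/integrableP; split; first exact/measurable_EFinP.
under eq_integral do rewrite /= ger0_norm//.
by rewrite -Pp// probability_setT ltry.
Qed.

Lemma density_dominates : P `<< mu.
Proof.
apply/null_content_dominatesP => A mA muA0; rewrite Pp//.
by apply: null_set_integral => //; apply/measurable_EFinP; exact: measurable_funTS.
Qed.

(** By uniqueness of densities [p] coincides almost everywhere with the Radon-Nikodym derivative,
    for which the change of variables is known. *)
Lemma ge0_integral_density (f : Z -> R) : measurable_fun setT f -> (forall z, 0 <= f z) ->
  (\int[P]_z (f z)%:E = \int[mu]_z (f z * p z)%:E)%E.
Proof.
move=> mf f0.
pose mu' : {sigma_finite_measure set Z -> \bar R} := with_sigma_finite mu sfmu.
have dom : P `<< mu' := density_dominates.
pose g := Radon_Nikodym_SigmaFinite.f P mu'.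
have pg : ae_eq mu setT (EFin \o p) g.
  apply: integral_ae_eq => //; first exact: density_integrable.
    exact: measurable_int (Radon_Nikodym_SigmaFinite.f_integrable dom).
  by move=> E _ mE; rewrite -Pp// (Radon_Nikodym_SigmaFinite.f_integral dom).
rewrite -(Radon_Nikodym_SigmaFinite.change_of_variables dom)//; last exact/measurable_EFinP.
apply: ae_eq_integral => //.
- apply: emeasurable_funM; first exact/measurable_EFinP.
  exact: measurable_int (Radon_Nikodym_SigmaFinite.f_integrable dom).
- by apply/measurable_EFinP; exact: measurable_funM.
- apply: filterS pg => z /= /(_ Logic.I) h _; rewrite EFinM.
  by congr (_ * _)%E; exact/esym.
Qed.

(** With [y = ln q - ln p], the function [expR y - 1 - y] is nonnegative and vanishes only at
    [y = 0]. Its integral is at most 0, because [expR y] integrates to at most 1 and [y] to at least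
    0. *)
Lemma gibbs_eq (q : Z -> R) : (forall z, 0 < p z) -> measurable_fun setT q ->
  (forall z, 0 < q z) -> (\int[mu]_z (q z)%:E <= 1)%E ->
  P.-integrable setT (fun z => (ln (p z) - ln (q z))%:E) ->
  (\int[P]_z (ln (p z) - ln (q z))%:E <= 0)%E ->
  P [set z | ln (q z) != ln (p z)] = 0.
Proof.
move=> p_gt0 mq q_gt0 q1 ipq KL0.
pose y z := ln (q z) - ln (p z).
have mlnp : measurable_fun setT (fun z => ln (p z)) by exact: measurableT_comp.
have mlnq : measurable_fun setT (fun z => ln (q z)) by exact: measurableT_comp.
have my : measurable_fun setT y by exact: measurable_funB.
have mexpy : measurable_fun setT (fun z => expR (y z)) by exact: measurableT_comp.
have Iexp : (\int[P]_z (expR (y z))%:E <= 1)%E.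
  rewrite ge0_integral_density//.
  apply: le_trans q1; rewrite le_eqVlt; apply/orP; left; apply/eqP.
  apply: eq_integral => z _; congr EFin.
  by rewrite /y expRD expRN !lnK ?posrE// divfK// gt_eqF.
have iexp : P.-integrable setT (fun z => (expR (y z))%:E).
  apply/integrableP; split; first exact/measurable_EFinP.
  under eq_integral do rewrite abse_EFin ger0_norm ?expR_ge0//.
  by apply: le_lt_trans Iexp _; rewrite ltry.
have iy : P.-integrable setT (fun z => (y z)%:E).
  have := integrableN ipq; apply: eq_integrable => // z _ /=.
  by rewrite opprB.
have i1 : P.-integrable setT (fun=> 1%E : \bar R).
  exact: finite_measure_integrable_cst.
have Iy : (0 <= \int[P]_z (y z)%:E)%E.
  rewrite (_ : (fun z => _) = (fun z => - (ln (p z) - ln (q z))%:E)%E); last first.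
    by apply/funext => z; rewrite -EFinN opprB.
  by rewrite integralN ?oppe_ge0//; exact: integrable_add_def.
pose phi z := expR (y z) - (1 + y z).
have phi0 z : 0 <= phi z by rewrite subr_ge0 expR_ge1Dx.
have mphi : measurable_fun setT phi by apply: measurable_funB => //; exact: measurable_funD.
have Iphi : (\int[P]_z `|(phi z)%:E| = 0)%E.
  under eq_integral do rewrite abse_EFin ger0_norm//.
  apply/eqP; rewrite eq_le; apply/andP; split; last first.
    by apply: integral_ge0 => z _; rewrite lee_fin.
  rewrite (_ : (fun z => _) = (fun z => (expR (y z))%:E - (1%:E + (y z)%:E))%E)//.
  rewrite integralB//=; last exact: (@integrableD _ _ _ _ _ _ _ _ i1 iy).
  rewrite integralD// integral_cst// (_ : _ setT = 1%E); last exact: probability_setT.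
  rewrite mule1 leeBlDr//.
    by rewrite add0e; apply: (le_trans Iexp); rewrite leeDl.
  by rewrite fin_numD /=; exact: integrable_fin_num.
have mEphi : measurable_fun setT (fun z => (phi z)%:E) by exact/measurable_EFinP.
have [N [mN N0 HN]] := (ae_eq_integral_abs P measurableT mEphi).1 Iphi.
apply/eqP; rewrite eq_le measure_ge0 andbT -N0; apply: le_measure; rewrite ?inE//.
- exact: measurable_set_neq.
- move=> z /= pq; apply: HN => /= /(_ Logic.I) /= [] /eqP; apply/negP.
  by rewrite subr_eq0 gt_eqF// expR_gt1Dx// /y subr_eq0.
Qed.

End density.

(** * Countable dense subsets of compact sets *)

Section separable.
Context {R : realType} {T : pseudoMetricType R}.

Lemma compact_countable_dense (A : set T) : compact A -> A !=set0 ->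
  exists t : nat -> T, (forall j, A (t j)) /\
    forall x (U : set T), A x -> nbhs x U -> exists j, U (t j).
Proof.
move=> cA [x0 Ax0].
have fin n : exists D : set T, [/\ finite_set D, D `<=` A &
    forall x, A x -> exists2 y, D y & ball y n.+1%:R^-1 x].
  (* The finite subsets of [A], directed by inclusion: along this filter each point eventually has a
     neighbourhood served by one center, and the near-covering form of compactness yields a single
     finite net. *)
  pose F : set_system (set T) := [set U | exists D0, [/\ finite_set D0, D0 `<=` A &
    forall D, finite_set D -> D `<=` A -> D0 `<=` D -> U D]].
  have FF : Filter F.
    split; first by exists set0; split.
    - move=> U V [D0 [fD0 D0A hU]] [D1 [fD1 D1A hV]]; exists (D0 `|` D1); split.
      + by rewrite finite_setU.
      + by rewrite subUset.
      + move=> D fD DA; rewrite subUset => -[D0D D1D].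
        by split; [exact: hU|exact: hV].
    - move=> U V UV [D0 [fD0 D0A hU]]; exists D0; split => // D fD DA D0D.
      by apply: UV; exact: hU.
  have /compact_near_coveringP/(_ _ F (fun D x => exists2 y, D y & ball y n.+1%:R^-1 x) FF) := cA.
  case=> [x Ax|D0 [fD0 D0A /(_ D0 fD0 D0A (fun _ h => h)) h]]; last by exists D0; split.
  exists (ball x n.+1%:R^-1, [set D | D x]) => /=; last by move=> [y D] /= [xy Dx]; exists x.
  split; first by apply: nbhsx_ballx; rewrite invr_gt0.
  exists [set x]; split => //; first by move=> _ ->.
  by move=> D _ _; apply.
have [D HD] := choice fin.
pose E := \bigcup_n D n.
have cE : countable E.
  by apply: bigcup_countable => // n _; apply: finite_set_countable; case: (HD n).
have /pfcard_geP[E0|[t]] := cE.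
  have [_ _ /(_ x0 Ax0)[y yD _]] := HD 0%N.
  have Ey : E y by exists 0%N.
  by rewrite E0 in Ey.
exists t; split.
  move=> j; have [n _] : E (t j) by exact: funS.
  by have [_ DA _] := HD n; exact: DA.
move=> x U Ax /nbhs_ballP[e /= e0 eU].
have [n ne] : exists n, (n.+1%:R^-1 : R) < e.
  exists (Num.truncn e^-1); rewrite invf_plt ?posrE//.
  exact: truncnS_gt.
have [_ _ /(_ x Ax)[y yD xy]] := HD n.
have [j _ tj] : exists2 j, setT j & t j = y.
  by have := @surj _ _ _ _ t y; apply; exists n.
exists j; rewrite tj; apply: eU; apply: (le_ball (ltW ne)).
exact: ball_sym.
Qed.

End separable.

(** * Exponential moments of envelopes in the tau-class *)

Section Ltau.
Context {R : realType} {d} {Z : measurableType d} {Q : probability Z R}.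

(** Halving the exponent leaves room for the linear term that [tau] subtracts: with
    [u = expR (|s| / 2)] and [|s| <= 2 (u - 1)], the claim reduces to [u^2 - 3 u + 3 >= 0]. *)
Lemma expR_half_le_tau (s : R) : expR (`|s| / 2) <= 2 + tau s.
Proof.
rewrite /tau; have -> : expR `|s| = expR (`|s| / 2) * expR (`|s| / 2).
  by rewrite -expRD; congr expR; lra.
have := expR_ge1Dx (`|s| / 2); set u := expR _ => su.
have := sqr_ge0 (u - 3 / 2); rewrite expr2; lra.
Qed.

Lemma in_Ltau_expR (G : Z -> R) : in_Ltau Q G -> exists2 a, 0 < a &
  (\int[Q]_z (expR (a * `|G z|))%:E < +oo)%E.
Proof.
move=> [mG [a a0 taua]].
have mtau : measurable_fun setT (fun z => tau (G z / a)).
  have mGa : measurable_fun setT (fun z => `|G z / a|).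
    by apply: measurableT_comp => //; exact: measurable_funM.
  apply: measurable_funB => //; apply: measurable_funB => //.
  exact: measurableT_comp.
have tau0 z : 0 <= tau (G z / a).
  by rewrite /tau; have := expR_ge1Dx `|G z / a|; lra.
exists (2 * a)^-1; first by rewrite invr_gt0 mulr_gt0.
apply: (@le_lt_trans _ _ (\int[Q]_z (2%:E + (tau (G z / a))%:E))%E).
  apply: ge0_le_integral => //.
  - apply/measurable_EFinP; apply: measurableT_comp => //; apply: measurable_funM => //.
    exact: measurableT_comp.
  - by apply: emeasurable_funD => //; exact/measurable_EFinP.
  - move=> z _; rewrite -EFinD lee_fin; apply: le_trans (expR_half_le_tau _).
    rewrite ler_expR normf_div (gtr0_norm a0).
    by have -> : (2 * a)^-1 * `|G z| = `|G z| / a / 2 by field; rewrite gt_eqF.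
rewrite ge0_integralD//; last 2 first.
- by move=> z _; rewrite lee_fin.
- exact/measurable_EFinP.
rewrite integral_cst// (_ : _ setT = 1%E); last exact: probability_setT.
by rewrite mule1 lte_add_pinfty ?ltry.
Qed.

End Ltau.

(** * Deviation of the likelihood ratio *)

Section sample_path.
Context {R : realType} {dO} {O : measurableType dO} {d} {Z : measurableType d}
  (PO : probability O R) (X : nat -> O -> Z).

(** The measurability proof is an argument so that the measurable-function structure, and with it
    [distribution], can be inferred. *)
Definition sample_path (mX : forall i, measurable_fun setT (X i)) : O -> seqspace Z :=
  fun w i => X i w.

Lemma measurable_sample_path mX : measurable_fun setT (sample_path mX).
Proof. by apply: measurable_to_seqspace => i; exact: mX. Qed.

HB.instance Definition _ mX :=
  isMeasurableFun.Build _ _ _ _ (sample_path mX) (measurable_sample_path mX).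

Lemma iid_sample_path (Q : probability Z R) mX :
  iid_with_law PO X Q -> iid_law Q (distribution PO (sample_path mX)).
Proof.
move=> [_ XQ indep] n A mA An.
have := indep (index_iota 0 n) A (iota_uniq _ _) mA; rewrite big_mkord => h.
transitivity (\prod_(i < n) PO (X i @^-1` A i))%E; last by apply: eq_bigr => i _; exact: XQ.
rewrite -h; congr (PO _); apply/seteqP; split => w /=.
  by move=> Aw i _; exact: Aw.
move=> h' i; have [ni|ni] := leqP n i; first by rewrite An.
by apply: h'; rewrite /= mem_index_iota.
Qed.

End sample_path.

(** * From the likelihood ratio to the empirical process *)

Section overestimation.
Context {R : realType} {d} {Z : measurableType d} {mu : {measure set Z -> \bar R}}
  {Pstar : probability Z R} {pstar : Z -> R}
  {dO} {O : measurableType dO} {PO : probability O R} {X : nat -> O -> Z}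
  {Theta : pseudoMetricType R} {ThetaK : nat -> set Theta}
  {P : Theta -> probability Z R} {p : Theta -> Z -> R} {l u : Z -> R} {K : nat}.
Hypothesis sfmu : sigma_finite setT mu.
Hypothesis mpstar : measurable_fun setT pstar.
Hypothesis pstar_gt0 : forall z, 0 < pstar z.
Hypothesis Pstarp : forall A, measurable A -> Pstar A = (\int[mu]_(x in A) (pstar x)%:E)%E.
Hypothesis iidX : iid_with_law PO X Pstar.
Hypothesis mp : forall th, ThetaK K th -> measurable_fun setT (p th).
Hypothesis p_gt0 : forall th, ThetaK K th -> forall z, 0 < p th z.
Hypothesis Pp : forall th, ThetaK K th ->
  forall A, measurable A -> P th A = (\int[mu]_(x in A) (p th x)%:E)%E.
Hypothesis cK : compact (ThetaK K).
Hypothesis contp : forall z, {within ThetaK K, continuous (fun th => ln (p th z))}.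
Hypothesis iul : Pstar.-integrable setT (fun z => (u z - l z)%:E).
Hypothesis lustar : forall z, l z <= ln (pstar z) <= u z.
Hypothesis lup : forall th, ThetaK K th -> forall z, l z <= ln (p th z) <= u z.

Local Notation KLth := (KL Pstar pstar p).
Let ell th z := ln (p th z) - ln (pstar z).
Let h th := Num.sqrt (fine (KLth th)).
Let g th z := ell th z / h th.

Let mlnpstar : measurable_fun setT (fun z => ln (pstar z)).
Proof. exact: measurableT_comp. Qed.

Let mlnp th : ThetaK K th -> measurable_fun setT (fun z => ln (p th z)).
Proof. by move=> /mp mpth; exact: measurableT_comp. Qed.

Let mell th : ThetaK K th -> measurable_fun setT (ell th).
Proof. by move=> Kth; apply: measurable_funB => //; exact: mlnp. Qed.

Let mg th : ThetaK K th -> measurable_fun setT (g th).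
Proof. by move=> Kth; apply: measurable_funM => //; exact: mell. Qed.

Lemma KL_integrable th : ThetaK K th ->
  Pstar.-integrable setT (fun z => (ln (pstar z) - ln (p th z))%:E).
Proof.
move=> Kth; apply: le_integrable iul => //.
  by apply/measurable_EFinP; apply: measurable_funB => //; exact: mlnp.
move=> z _ /=; rewrite lee_fin; have := lustar z; have := lup th Kth z.
move=> /andP[? ?] /andP[? ?]; rewrite [leRHS]ger0_norm; last by lra.
by rewrite ler_norml; apply/andP; split; lra.
Qed.

Let KL_fin th : ThetaK K th -> KLth th \is a fin_num.
Proof. by move=> /KL_integrable; exact: integrable_fin_num. Qed.

(** Takes care of the parameters left out of [Gb]: their log-likelihood ratio vanishes almost
    surely. *)
Lemma KL_le0_eq th : ThetaK K th -> (KLth th <= 0)%E ->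
  Pstar [set z | ln (p th z) != ln (pstar z)] = 0%E.
Proof.
move=> Kth KL0; apply: (gibbs_eq mu Pstar pstar) => //.
- by move=> z; exact: ltW.
- exact: mp.
- exact: p_gt0.
- by rewrite -(Pp th)// probability_setT.
- exact: KL_integrable.
Qed.

(** Equal laws have [mu]-almost everywhere equal densities, and [Pstar] is dominated by [mu]. *)
Lemma true_density_eq th : ThetaK K th -> (forall A, measurable A -> P th A = Pstar A) ->
  Pstar [set z | ln (p th z) != ln (pstar z)] = 0%E.
Proof.
move=> Kth PthE.
have dom : Pstar `<< mu by exact: density_dominates Pstarp.
have : ae_eq mu setT (EFin \o p th) (EFin \o pstar).
  apply: integral_ae_eq => //.
  - apply: (density_integrable mu (P th)) => //; first exact: mp.
      by move=> z; apply: ltW; exact: p_gt0.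
    exact: Pp.
  - exact/measurable_EFinP.
  - by move=> E _ mE; rewrite -Pp// PthE// Pstarp.
move=> /(null_dominates_ae_eq measurableT dom)[N [mN N0 HN]].
apply/eqP; rewrite eq_le measure_ge0 andbT -N0; apply: le_measure; rewrite ?inE//.
  by apply: measurable_set_neq => //; exact: mlnp.
move=> z /= pz; apply: HN => /= /(_ Logic.I) [] e.
by rewrite e eqxx in pz.
Qed.

Let h_gt0 th : ThetaK K th -> (0 < KLth th)%E -> 0 < h th.
Proof.
move=> Kth KL0; rewrite sqrtr_gt0; apply: fine_gt0.
by rewrite KL0 ltey_eq KL_fin.
Qed.

(** The mean of [ell] is [- h^2], so after normalization the centering term is [- h]; it produces
    the drift [- n h^2] of the log-likelihood ratio. *)
Lemma PE_g th : ThetaK K th -> (0 < KLth th)%E -> PE Pstar (g th) = - h th.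
Proof.
move=> Kth KL0; have h0 := h_gt0 th Kth KL0.
rewrite /PE (_ : (fun z => _) = (fun z => (- (h th)^-1)%:E * (ln (pstar z) - ln (p th z))%:E)%E).
  rewrite integralZl//; last exact: KL_integrable.
  rewrite fineM//; last exact: KL_fin.
  rewrite -/(KLth th) /= mulNr; congr (- _).
  have e : fine (KLth th) = h th * h th.
    by rewrite -expr2 sqr_sqrtr// fine_ge0// ltW.
  by rewrite e mulKf// gt_eqF.
by apply/funext => z; rewrite -EFinM /g /ell; congr EFin; ring.
Qed.

Variable G : Z -> R.
Hypothesis envG : envelope (Gb ThetaK Pstar pstar p K) G.
Hypothesis mG : measurable_fun setT G.
Variable a : R.
Hypothesis a0 : 0 < a.
Hypothesis expG : (\int[Pstar]_z (expR (a * `|G z|))%:E < +oo)%E.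

Let mnG : measurable_fun setT (fun z => `|G z|).
Proof. exact: measurableT_comp. Qed.

Let mexpG : measurable_fun setT (fun z => expR (a * `|G z|)).
Proof. by apply: measurableT_comp => //; exact: measurable_funM. Qed.

Let IG : (\int[Pstar]_z `|G z|%:E < +oo)%E.
Proof.
apply: (@le_lt_trans _ _ (\int[Pstar]_z (a^-1%:E * (expR (a * `|G z|))%:E))%E).
  apply: ge0_le_integral => //.
  - exact/measurable_EFinP.
  - by apply: emeasurable_funM => //; exact/measurable_EFinP.
  - move=> z _; rewrite -EFinM lee_fin ler_pdivlMl//.
    by have := expR_ge1Dx (a * `|G z|); lra.
rewrite ge0_integralZl_EFin//.
- by rewrite lte_mul_pinfty// lee_fin invr_ge0 ltW.
- exact/measurable_EFinP.
- by rewrite invr_ge0 ltW.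
Qed.

Let b := fine (\int[Pstar]_z `|G z|%:E).

Let IG0 : (0 <= \int[Pstar]_z `|G z|%:E)%E.
Proof. by apply: integral_ge0 => z _; rewrite lee_fin. Qed.

Let bE : (\int[Pstar]_z `|G z|%:E)%E = b%:E.
Proof. by rewrite fineK// ge0_fin_numE. Qed.

Let b0 : 0 <= b. Proof. exact: fine_ge0. Qed.

Let g_le th : ThetaK K th -> (0 < KLth th)%E -> forall z, `|g th z| <= G z.
Proof. by move=> Kth KL0; apply: envG; exists th. Qed.

Let PE_g_le th : ThetaK K th -> (0 < KLth th)%E -> `|PE Pstar (g th)| <= b.
Proof.
move=> Kth KL0.
have mEg : measurable_fun setT (fun z => (g th z)%:E) by apply/measurable_EFinP; exact: mg.
have le : (`|\int[Pstar]_z (g th z)%:E| <= b%:E)%E.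
  apply: (le_trans (le_abse_integral _ _ _)) => //; rewrite -bE.
  apply: ge0_le_integral => //.
  - exact: measurableT_comp.
  - exact/measurable_EFinP.
  - move=> z _; rewrite lee_fin; apply: (le_trans (g_le th Kth KL0 z)).
    exact: ler_norm.
have fin : (\int[Pstar]_z (g th z)%:E)%E \is a fin_num.
  by rewrite -abse_fin_num ge0_fin_numE//; apply: le_lt_trans le _; rewrite ltry.
by rewrite -lee_fin /PE -abse_EFin fineK.
Qed.

Let emp_proc_mem n w : linf_mem (Gb ThetaK Pstar pstar p K) (emp_proc X Pstar n w).
Proof.
exists ((Num.sqrt n%:R)^-1 * \sum_(i < n) (`|G (X i w)| + b)) => _ [th [Kth KL0] <-].
rewrite /emp_proc normrM ger0_norm ?invr_ge0 ?sqrtr_ge0//.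
apply: ler_wpM2l; first by rewrite invr_ge0 sqrtr_ge0.
apply: (le_trans (ler_norm_sum _ _ _)); apply: ler_sum => i _.
apply: (le_trans (ler_normB _ _)); apply: lerD; last exact: PE_g_le.
exact: le_trans (g_le th Kth KL0 _) (ler_norm _).
Qed.

Hypothesis donskerK : donsker PO X Pstar (Gb ThetaK Pstar pstar p K).

Variables (v : nat -> R) (c : R) (thstar : Theta).
Hypothesis c0 : 0 < c.
Hypothesis v_gt0 : forall n, (1 <= n)%N -> 0 < v n.
Hypothesis voo : v n @[n --> \oo] --> +oo.
Hypothesis vn0 : v n / n%:R @[n --> \oo] --> 0.
Hypothesis Kthstar : ThetaK K thstar.
Hypothesis PthstarE : forall A, measurable A -> P thstar A = Pstar A.

Let mX : forall i, measurable_fun setT (X i). Proof. by case: iidX. Qed.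
Let L : probability (seqspace Z) R := distribution PO (sample_path X mX).
Let iidL : iid_law Pstar L. Proof. exact: iid_sample_path. Qed.

Let loglik_seq th n (w : nat -> Z) : R := \sum_(i < n) ln (p th (w i)).

Lemma loglik_within_cvg th n (w : nat -> Z) : ThetaK K th ->
  loglik_seq th' n w @[th' --> within (ThetaK K) (nbhs th)] --> loglik_seq th n w.
Proof.
move=> Kth; rewrite /loglik_seq; elim: n => [|n IH].
  by rewrite big_ord0; under eq_fun do rewrite big_ord0; exact: cvg_cst.
rewrite big_ord_recr; under eq_fun do rewrite big_ord_recr; apply: cvgD => //=.
by have /subspace_continuousP/(_ th Kth) := contp (w n).
Qed.

(** Quantifying over measurable events [E] asks nothing of the measurability of the uncountable
    supremum, and lets one bound serve both estimators. *)
Lemma overestimation_bound : exists2 c', 0 < c' & \forall n \near \oo,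
  forall E : set O, measurable E ->
    (forall w, E w -> v n * c + loglik p X thstar n w < supLL ThetaK p X n K w) ->
    (PO E <= (expR (- c' * v n))%:E)%E.
Proof.
have [th [Kth dense]] := compact_countable_dense (ThetaK K) cK (ex_intro _ _ Kthstar).
(* The zero function stands in for parameters of zero divergence, so that the family remains a
   sequence with a common envelope. *)
pose f j : Z -> R :=
  if (0 < KLth (th j))%E then (fun z => g (th j) z - PE Pstar (g (th j))) else (fun=> 0).
pose B z := `|G z| + b.
have mf j : measurable_fun setT (f j).
  by rewrite /f; case: ifP => // _; apply: measurable_funB => //; exact: mg.
have mB : measurable_fun setT B by exact: measurable_funD.
have fB j z : `|f j z| <= B z.
  rewrite /f /B; case: ifPn => [KL0|_]; last by rewrite normr0 addr_ge0.
  apply: (le_trans (ler_normB _ _)); apply: lerD; last exact: PE_g_le.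
  exact: le_trans (g_le _ (Kth j) KL0 _) (ler_norm _).
have expB : (\int[Pstar]_z (expR (a * B z))%:E < +oo)%E.
  under eq_integral do rewrite /B mulrDr expRD mulrC EFinM.
  rewrite ge0_integralZl_EFin//; last exact/measurable_EFinP.
  by rewrite lte_mul_pinfty// lee_fin expR_ge0.
have IB : (\int[Pstar]_z (B z)%:E < +oo)%E.
  under eq_integral do rewrite /B EFinD.
  rewrite ge0_integralD//; last exact/measurable_EFinP.
  rewrite bE integral_cst// (_ : _ setT = 1%E); last exact: probability_setT.
  by rewrite mule1 -EFinD ltry.
have tight0 e : 0 < e -> exists M N0, forall J n, (N0 <= n)%N ->
    (L [set w | M * Num.sqrt n%:R < maxsum f J n w]%R <= e%:E)%E.
  move=> e0; have [M [N0 HM]] := donsker_tight emp_proc_mem donskerK e e0.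
  (* The maxima keep the level nonnegative, so that the zero functions never exceed it, and make
     [sqrt n] invertible. *)
  exists (Num.max M 0), (maxn N0 1) => J n; rewrite geq_max => /andP[N0n n1].
  apply: (HM n N0n (sample_path X mX @^-1` [set w | Num.max M 0 * Num.sqrt n%:R < maxsum f J n w])).
    rewrite -[X in measurable X]setTI; apply: measurable_sample_path => //.
    by apply: measurable_set_lt => //; exact: measurable_maxsum.
  move=> w /=; set ww := sample_path X mX w => hw.
  have sn0 : 0 < Num.sqrt n%:R :> R by rewrite sqrtr_gt0 ltr0n.
  have M0 : 0 <= Num.max M 0 by rewrite le_max lexx orbT.
  have [j jJ hj] : exists2 j, (j < J)%N & Num.max M 0 * Num.sqrt n%:R < `|psum f j n ww|.
    apply: contrapT => hno; move: hw; rewrite ltNge => /negP; apply.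
    apply: bigmax_le; first by rewrite mulr_ge0// sqrtr_ge0.
    by move=> j _; rewrite leNgt; apply/negP => hj; apply: hno; exists (nat_of_ord j).
  have [KL0|KL0] := boolP (0 < KLth (th j))%E; last first.
    move: hj; rewrite /psum /f (negbTE KL0) big1// normr0 ltNge.
    by rewrite mulr_ge0// sqrtr_ge0.
  exists (g (th j)); first by exists (th j).
  rewrite /emp_proc normrM ger0_norm ?invr_ge0 ?sqrtr_ge0//.
  apply: (@le_lt_trans _ _ (Num.max M 0)); first by rewrite le_max lexx.
  by rewrite ltr_pdivlMl// mulrC; move: hj; rewrite /psum /f KL0.
have tight := tight_maxsum _ _ iidL f B mf mB fB IB tight0.
have sc0 : 0 < 2 * Num.sqrt c by rewrite mulr_gt0// sqrtr_gt0.
have [c' c'0 Hc'] := moderate_deviation _ _ iidL f B mf mB fB a a0 expB tight v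
  (2 * Num.sqrt c) sc0 voo vn0.
exists c' => //; near=> n => E mE HE.
have n1 : (1 <= n)%N by near: n; exact: nbhs_infty_ge.
have v0 : 0 < v n by exact: v_gt0.
have HJ : forall J, (L [set w | 2 * Num.sqrt c * Num.sqrt (n%:R * v n) < maxsum f J n w]%R
    <= (expR (- c' * v n))%:E)%E by near: n.
pose SJ J : set (seqspace Z) := [set w | 2 * Num.sqrt c * Num.sqrt (n%:R * v n) < maxsum f J n w].
have mSJ J : measurable (SJ J) by apply: measurable_set_lt => //; exact: measurable_maxsum.
pose Nj th : set Z := [set z | ln (p th z) != ln (pstar z)].
pose NJ j : set Z := if (0 < KLth (th j))%E then set0 else Nj (th j).
have mNj th' : ThetaK K th' -> measurable (Nj th').
  by move=> Kth'; apply: measurable_set_neq => //; exact: mlnp.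
have mNJ j : measurable (NJ j) by rewrite /NJ; case: ifP => // _; exact: mNj.
(* Outside this null set [p thstar] and all zero-divergence [p (th j)] equal [pstar]. It is
   countable in j, which is why density of the sequence is used before discarding it. *)
pose N0 : set Z := Nj thstar `|` \bigcup_j NJ j.
have mN0 : measurable N0.
  by apply: measurableU; [exact: mNj|exact: bigcup_measurable].
have PN0 : Pstar N0 = 0%E.
  apply/(@negligibleP _ _ _ _ _ mN0); apply: negligibleU.
    by apply/(@negligibleP _ _ _ _ _ (mNj _ Kthstar)); exact: true_density_eq.
  apply: negligible_bigcup => j; apply/(@negligibleP _ _ _ _ _ (mNJ j)).
  rewrite /NJ; case: ifPn => [_|]; first exact: measure0.
  by rewrite -leNgt => /KL_le0_eq; apply.
pose Null : set (seqspace Z) := \bigcup_i [set w | N0 (w i)].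
have mNi i : measurable [set w : seqspace Z | N0 (w i)].
  by rewrite -[X in measurable X]setTI; exact: measurable_coord.
have mNull : measurable Null by exact: bigcup_measurable.
have LNull : L Null = 0%E.
  apply/(@negligibleP _ _ _ _ _ mNull); apply: negligible_bigcup => i.
  apply/(@negligibleP _ _ _ _ _ (mNi i)); rewrite -PN0.
  by have [_ XQ _] := iidX; exact: XQ.
(* The events increase with J and the bound is uniform in J, so continuity from below carries it to
   the whole dense sequence. *)
have LU : (L (\bigcup_J SJ J) <= (expR (- c' * v n))%:E)%E.
  have cv : L (SJ J) @[J --> \oo] --> L (\bigcup_J SJ J).
    apply: nondecreasing_cvg_mu => //; first exact: bigcup_measurable.
    move=> J J' JJ'; apply/subsetPset => w /lt_le_trans; apply.
    apply: bigmax_le; first exact: maxsum_ge0.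
    by move=> j _; apply: maxsum_ge; exact: leq_trans (ltn_ord j) JJ'.
  rewrite -(cvg_lim _ cv)//; apply: lime_le; first exact: cvgP cv.
  exact: nearW.
have mNS : measurable (Null `|` \bigcup_J SJ J).
  by apply: measurableU => //; exact: bigcup_measurable.
have EL : (PO E <= L (Null `|` \bigcup_J SJ J))%E.
  have mpre : measurable (sample_path X mX @^-1` (Null `|` \bigcup_J SJ J)).
    by rewrite -[X in measurable X]setTI; exact: measurable_sample_path.
  apply: (le_measure PO (mem_set mE) (mem_set mpre)) => w Ew.
  have [Nw|Nw] := pselect (Null (sample_path X mX w)); [by left|right].
  have eqstar i : ln (p thstar (X i w)) = ln (pstar (X i w)).
    apply/eqP/negPn/negP => neq; apply: Nw; exists i => //.
    by left.
  have [_ [th0 Kth0 <-] lt0] : exists2 y, [set loglik p X th n w | th in ThetaK K] y &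
      v n * c + loglik p X thstar n w < y.
    by apply: sup_gt (HE w Ew); exists (loglik p X thstar n w), thstar.
  (* A strict inequality at [th0] persists in a neighbourhood within [ThetaK K], which the dense
     sequence meets. *)
  have [j ltj] : exists j, v n * c + loglik p X thstar n w < loglik p X (th j) n w.
    have nb : nbhs (loglik_seq th0 n (sample_path X mX w))
        [set x | v n * c + loglik p X thstar n w < x].
      by apply: open_nbhs_nbhs; split; [exact: open_gt|exact: lt0].
    have [j ltj] := dense th0 _ Kth0
      (loglik_within_cvg th0 n (sample_path X mX w) Kth0 _ nb).
    by exists j; exact: ltj (Kth j).
  have loglikE : loglik p X (th j) n w - loglik p X thstar n w =
      \sum_(i < n) ell (th j) (X i w).
    by rewrite /loglik -sumrB; apply: eq_bigr => i _; rewrite eqstar.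
  have vc0 : 0 < v n * c by rewrite mulr_gt0.
  have [KL0|KL0] := boolP (0 < KLth (th j))%E; last first.
    have ell0 i : ell (th j) (X i w) = 0.
      apply/eqP/negPn/negP => neq; apply: Nw; exists i => //; right; exists j => //.
      by rewrite /NJ (negbTE KL0) /Nj /=; rewrite /ell subr_eq0 in neq.
    by move: loglikE; rewrite big1//; lra.
  exists j.+1 => //; apply: lt_le_trans (maxsum_ge f j.+1 j n _ (ltnSn j)).
  apply: lt_le_trans (ler_norm _).
  have hj0 := h_gt0 _ (Kth j) KL0; set S := psum _ _ _ _.
  have ellE : \sum_(i < n) ell (th j) (X i w) = h (th j) * S - n%:R * h (th j) ^+ 2.
    rewrite /S /psum mulr_sumr -[n in n%:R]card_ord -sumr_const mulr_suml -sumrB.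
    apply: eq_bigr => i _; rewrite /f KL0 PE_g// /g; field.
    by rewrite gt_eqF.
  (* If [S <= 2 A], then n times the log-likelihood ratio is at most [2 n A h - n^2 h^2 = A^2 - (A -
     n h)^2 <= A^2 = c n v_n], contradicting the excess [c v_n]. *)
  pose A := Num.sqrt c * Num.sqrt (n%:R * v n).
  have n0 : 0 < n%:R :> R by rewrite ltr0n.
  have A2 : A ^+ 2 = c * (n%:R * v n).
    by rewrite exprMn !sqr_sqrtr// ltW// mulr_gt0.
  rewrite -mulrA -/A ltNge; apply/negP => SA.
  have hS : h (th j) * S <= h (th j) * (2 * A) by rewrite ler_wpM2l// ltW.
  have lt1 : v n * c < h (th j) * (2 * A) - n%:R * h (th j) ^+ 2.
    by rewrite ellE in loglikE; lra.
  have : n%:R * (v n * c) < n%:R * (h (th j) * (2 * A) - n%:R * h (th j) ^+ 2).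
    by rewrite ltr_pM2l.
  have := sqr_ge0 (A - n%:R * h (th j)).
  have -> : (A - n%:R * h (th j)) ^+ 2 =
     A ^+ 2 - n%:R * (h (th j) * (2 * A) - n%:R * h (th j) ^+ 2) by ring.
  by rewrite A2; lra.
apply: (le_trans EL); apply: (@le_trans _ _ (L Null + L (\bigcup_J SJ J))%E).
  by apply: measureU2 => //; exact: bigcup_measurable.
by rewrite LNull add0e.
Unshelve. all: by end_near. Qed.

End overestimation.

(** * Error exponents *)

(** Integrality gives a gap: all elements are at least [k + 1], hence so is the infimum. An empty
    [T] fits too, with infimum [+oo]. *)
Lemma lt_ereal_inf_nat {R : realType} (T : set nat) k :
  ((k%:R : R)%:E < ereal_inf [set (K%:R)%:E | K in T])%E <-> forall K, T K -> (k < K)%N.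
Proof.
split=> [kT K TK|kT].
  rewrite -(ltr_nat R) -lte_fin; apply: lt_le_trans kT _.
  by apply: ereal_inf_lbound; exists K.
apply: (@lt_le_trans _ _ (k.+1%:R)%:E); first by rewrite lte_fin ltr_nat.
by apply: le_ereal_inf_tmp => _ [K TK <-]; rewrite lee_fin ler_nat; exact: kT.
Qed.

Lemma measurable_lt_ereal_inf_nat {R : realType} {d} {O : measurableType d}
    (T : O -> set nat) k : (forall K, measurable [set w | T w K]) ->
  measurable [set w | ((k%:R : R)%:E < ereal_inf [set (K%:R)%:E | K in T w])%E].
Proof.
move=> mT; rewrite (_ : mkset _ = \bigcap_(K in [set K | (K <= k)%N]) ~` [set w | T w K]).
  by apply: bigcap_measurableType => K _; exact: measurableC.
apply/seteqP; split => w /=.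
  by move=> /lt_ereal_inf_nat kT K /= Kk /= /kT; rewrite ltnNge Kk.
move=> kT; apply/lt_ereal_inf_nat => K TK; rewrite ltnNge; apply/negP => Kk.
exact: kT Kk TK.
Qed.

Lemma limn_esup_elog_lt0 {R : realType} (v : nat -> R) (x : nat -> \bar R) (c : R) :
  0 < c -> (forall n, (1 <= n)%N -> 0 < v n) -> (forall n, 0 <= x n)%E ->
  (\forall n \near \oo, (x n <= (expR (- c * v n))%:E)%E) ->
  (limn_esup (fun n => ((v n)^-1)%:E * elog (x n)) < 0)%E.
Proof.
move=> c0 v0 x0 xc.
apply: (@le_lt_trans _ _ (- c)%:E); last by rewrite lte_fin; lra.
have [N _ HN] : \forall n \near \oo, (1 <= n)%N /\ (x n <= (expR (- c * v n))%:E)%E.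
  by apply: filterI => //; exact: nbhs_infty_ge.
apply: (@le_trans _ _ (ereal_sup ((fun n => ((v n)^-1)%:E * elog (x n))%E @` [set n | (N <= n)%N]))).
  by apply: ereal_inf_lbound; exists [set n | (N <= n)%N] => //; exists N.
apply: ge_ereal_sup => _ [n /= /HN[n1 xn] <-].
have vn0 := v0 n n1; have vi0 : 0 < (v n)^-1 by rewrite invr_gt0.
(* At probability 0 the logarithm is [-oo], and the positive factor preserves it. *)
rewrite /elog; case: ifPn => xn0; first by rewrite gt0_muleNy ?lte_fin// leNye.
have xfin : x n \is a fin_num.
  by rewrite ge0_fin_numE//; apply: le_lt_trans xn _; rewrite ltry.
have fx0 : 0 < fine (x n).
  by apply: fine_gt0; rewrite lt0e xn0 x0 /= ltey_eq xfin.
rewrite -EFinM lee_fin ler_pdivrMl// [v n * _]mulrC -ler_expR lnK ?posrE//.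
by rewrite -lee_fin fineK.
Qed.

Theorem theorem11
  (R : realType)
  (* Polish sample space Z (metric dZ), sigma-finite dominating measure mu *)
  (d : measure_display) (Z : measurableType d) (dZ : Z -> Z -> R)
  (mu : {measure set Z -> \bar R})
  (* true law P* with density p* *)
  (Pstar : probability Z R) (pstar : Z -> R)
  (* i.i.d. sample Z_1, Z_2, ... defined on (O, PO) *)
  (dO : measure_display) (O : measurableType dO) (PO : probability O R)
  (X : nat -> O -> Z)
  (* nested parameter spaces Theta_K inside a metric space Theta *)
  (Theta : pseudoMetricType R) (ThetaK : nat -> set Theta)
  (P : Theta -> probability Z R) (p : Theta -> Z -> R)
  (* envelope bounds of (A3) *)
  (l u : Z -> R)
  (* penalty pen(n,K) = v_n D(K) *)
  (v : nat -> R) (D : nat -> R)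
  (* true order *)
  (Kstar : nat) :
  (* setting *)
  polish_borel dZ ->
  sigma_finite setT mu ->
  measurable_fun setT pstar -> (forall z, 0 <= pstar z) ->
  (forall A, measurable A -> Pstar A = (\int[mu]_(x in A) (pstar x)%:E)%E) ->
  iid_with_law PO X Pstar ->
  hausdorff_space Theta ->
  (forall K, (1 <= K)%N -> ThetaK K `<=` ThetaK K.+1) ->
  (forall th, (\bigcup_(K in [set K : nat | (1 <= K)%N]) ThetaK K) th ->
     measurable_fun setT (p th) /\ (forall z, 0 <= p th z) /\
     forall A, measurable A -> P th A = (\int[mu]_(x in A) (p th x)%:E)%E) ->
  (* (A1) *)
  (forall K, (1 <= K)%N -> compact (ThetaK K)) ->
  (forall K, (1 <= K)%N -> weak_compact dZ (P @` ThetaK K)) ->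
  (* (A2) *)
  (forall z K, (1 <= K)%N -> {within ThetaK K, continuous (fun th => ln (p th z))}) ->
  (* (A3) *)
  Pstar.-integrable setT (fun z => (u z - l z)%:E) ->
  (forall z, 0 < pstar z /\ l z <= ln (pstar z) <= u z) ->
  (forall th, (\bigcup_(K in [set K : nat | (1 <= K)%N]) ThetaK K) th ->
     forall z, 0 < p th z /\ l z <= ln (p th z) <= u z) ->
  (* (A4) for pen(n,K) = v_n D(K) *)
  (forall n K, (1 <= n)%N -> (1 <= K)%N -> 0 < v n * D K) ->
  (forall n K K', (1 <= n)%N -> (1 <= K)%N -> (K < K')%N -> v n * D K < v n * D K') ->
  (forall K, (1 <= K)%N -> ((fun n => v n * D K) @ \oo --> +oo)) ->
  (forall K, (1 <= K)%N -> ((fun n => v n * D K / n%:R) @ \oo --> 0)) ->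
  (* all suprema are measurable *)
  (forall n K, measurable_fun setT (supLL ThetaK p X n K)) ->
  (* P* is of order Kstar: P* in Pi_{K*} \ Pi_{K*-1} *)
  (exists2 th, ThetaK Kstar th /\ (1 <= Kstar)%N &
     forall A, measurable A -> P th A = Pstar A) ->
  ~ (exists2 th, ThetaK Kstar.-1 th /\ (1 <= Kstar.-1)%N &
     forall A, measurable A -> P th A = Pstar A) ->
  (* conditions on (v_n) *)
  (forall n, (1 <= n)%N -> 0 < v n) ->
  (forall n m, (1 <= n)%N -> (n <= m)%N -> v n <= v m) ->
  ((fun n => v n / n%:R) @ \oo --> 0) ->
  (exists (A delta : R), [/\ 1 <= A, 0 < delta < 1 &
     forall k n, (1 <= k)%N -> (1 <= n)%N ->
       v (n * k)%N <= A * (k%:R `^ (1 - delta)) * v n]) ->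
  (* (i) envelopes in L_tau of P-star *)
  (forall K, (1 <= K)%N -> exists2 G, envelope (Gb ThetaK Pstar pstar p K) G & in_Ltau Pstar G) ->
  (* (ii) log n = o(v_n) *)
  ((fun n => ln n%:R / v n) @ \oo --> 0) ->
  (* (a) *)
  (donsker PO X Pstar (Gb ThetaK Pstar pstar p Kstar.+1) ->
     (limn_esup (fun n => ((v n)^-1)%:E *
        elog (PO [set w | ((Kstar%:R)%:E < KhatL ThetaK p X (fun n K => (v n * D K)%R) n w)%E]))
      < 0)%E)
  /\
  (* (b) *)
  (forall Kmax, (Kstar <= Kmax)%N ->
     donsker PO X Pstar (Gb ThetaK Pstar pstar p Kmax) ->
     (limn_esup (fun n => ((v n)^-1)%:E *
        elog (PO [set w | ((Kstar%:R)%:E < KhatG ThetaK p X (fun n K => (v n * D K)%R) Kmax n w)%E]))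
      < 0)%E).
Proof.
move=> _ sfmu mpstar _ Pstarp iidX _ nested densp cK _ contp iul lustar lup pen_gt0 Dincr voo0 _
  mSup [thstar [Kthstar Kstar1] PthstarE] _ v_gt0 _ vn0 _ env _.
have in_cup K th : (1 <= K)%N -> ThetaK K th ->
    (\bigcup_(K in [set K : nat | (1 <= K)%N]) ThetaK K) th by move=> K1 Kth; exists K.
have nest K K' : (1 <= K)%N -> (K <= K')%N -> ThetaK K `<=` ThetaK K'.
  move=> K1 /subnK <-; elim: (K' - K)%N => [|n IH]; first by rewrite add0n.
  apply: (subset_trans IH); rewrite addSn; apply: nested.
  exact: leq_trans K1 (leq_addl _ _).
have Dlt K K' : (1 <= K)%N -> (K < K')%N -> D K < D K'.
  by move=> K1 KK'; have := Dincr 1%N K K' isT K1 KK'; rewrite ltr_pM2l// v_gt0.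
(* Since [D] increases, every order above [Kstar] costs at least [v n * c] more in penalty. *)
pose c := D Kstar.+1 - D Kstar.
have c0 : 0 < c by rewrite subr_gt0 Dlt.
have voo : v n @[n --> \oo] --> +oo.
  have D1 : 0 < D 1%N by have := pen_gt0 1%N 1%N isT isT; rewrite pmulr_rgt0// v_gt0.
  apply/cvgryPge => A; have /cvgryPge/(_ (A * D 1%N)) := voo0 1%N isT.
  by apply: filterS => n; rewrite ler_pM2r.
have supLL_ge K th n w : (1 <= K)%N -> ThetaK K th ->
    loglik p X th n w <= supLL ThetaK p X n K w.
  move=> K1 Kth; apply: ub_le_sup; last by exists th.
  exists (\sum_(i < n) u (X i w)) => _ [th' Kth' <-]; apply: ler_sum => i _.
  by have [_ /andP[]] := lup th' (in_cup K th' K1 Kth') (X i w).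
have supLL_le K K' n w : (1 <= K)%N -> (K <= K')%N -> ThetaK K !=set0 ->
    supLL ThetaK p X n K w <= supLL ThetaK p X n K' w.
  move=> K1 KK' [th Kth]; apply: ge_sup; first by exists (loglik p X th n w), th.
  move=> _ [th' Kth' <-]; apply: supLL_ge; first exact: leq_trans K1 KK'.
  exact: nest Kth'.
have mcrit K n : measurable_fun setT (crit ThetaK p X (fun n K => v n * D K) n K).
  exact: measurable_funB.
(* The supremum over [ThetaK Kstar] dominates the likelihood at [thstar], so an excess over the
   former is one over the latter. It is applied with [K = Kstar.+1] for (a) and [K = Kmax] for
   (b). *)
have bound K : (Kstar <= K)%N -> donsker PO X Pstar (Gb ThetaK Pstar pstar p K) ->
  exists2 c', 0 < c' & \forall n \near \oo,
  forall E : set O, measurable E ->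
    (forall w, E w -> v n * c + supLL ThetaK p X n Kstar w < supLL ThetaK p X n K w) ->
    (PO E <= (expR (- c' * v n))%:E)%E.
  move=> KK dK; have K1 : (1 <= K)%N by exact: leq_trans KK.
  have [G envG LtG] := env K K1.
  have [a a0 expG] := in_Ltau_expR _ LtG.
  have [c' c'0 Hc'] := overestimation_bound sfmu mpstar (fun z => (lustar z).1) Pstarp iidX
    (fun th Kth => (densp th (in_cup K th K1 Kth)).1)
    (fun th Kth z => (lup th (in_cup K th K1 Kth) z).1)
    (fun th Kth => (densp th (in_cup K th K1 Kth)).2.2)
    (cK K K1) (fun z => contp z K K1) iul (fun z => (lustar z).2)
    (fun th Kth z => (lup th (in_cup K th K1 Kth) z).2)
    G envG LtG.1 a a0 expG dK v c thstar c0 v_gt0 voo vn0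
    (nest _ _ Kstar1 KK _ Kthstar) PthstarE.
  exists c' => //; apply: filterS Hc' => n Hn E mE HE; apply: Hn => // w Ew.
  apply: le_lt_trans (HE w Ew); rewrite lerD2l; exact: supLL_ge.
split.
- move=> dK; have [c' c'0 Hc'] := bound _ (leqnSn _) dK.
  apply: (limn_esup_elog_lt0 v _ c') => //; apply: filterS Hc' => n; apply.
    apply: measurable_lt_ereal_inf_nat => K.
    case: (leqP 1 K) => K1; last first.
      by rewrite (_ : mkset _ = set0)//; apply/seteqP; split => w //= [+ _]; rewrite leqNgt K1.
    rewrite (_ : mkset _ = [set w | crit ThetaK p X (fun n K => v n * D K) n K.+1 w <=
      crit ThetaK p X (fun n K => v n * D K) n K w]); first exact: measurable_set_le.
    by apply/seteqP; split => w //= [].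
  move=> w /lt_ereal_inf_nat hK.
  (* If the infimum exceeds [Kstar], then [Kstar] fails the stopping rule: the gain in likelihood
     from [Kstar] to [Kstar.+1] beats the penalty gap. *)
  rewrite ltNge; apply/negP => hle.
  suff : (Kstar < Kstar)%N by rewrite ltnn.
  apply: hK; split => //.
  by rewrite /crit /c in hle *; lra.
- move=> Kmax KK dK; have [c' c'0 Hc'] := bound _ KK dK.
  apply: (limn_esup_elog_lt0 v _ c') => //.
  apply: filterS2 (nbhs_infty_ge 1) Hc' => n n1; apply.
    apply: measurable_lt_ereal_inf_nat => K.
    case: (boolP (1 <= K <= Kmax)%N) => K1; last first.
      by rewrite (_ : mkset _ = set0)//; apply/seteqP; split => w //= []; rewrite (negbTE K1).
    rewrite (_ : mkset _ = \bigcap_(K' in [set K' | (1 <= K' <= Kmax)%N])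
      [set w | crit ThetaK p X (fun n K => v n * D K) n K' w <=
      crit ThetaK p X (fun n K => v n * D K) n K w]).
      by apply: bigcap_measurableType => K' _; exact: measurable_set_le.
    by apply/seteqP; split => w //= [].
  move=> w /lt_ereal_inf_nat hK.
  pose cr K := crit ThetaK p X (fun n K => v n * D K) n K w.
  (* The range is finite, so a maximizer exists. It lies above [Kstar] on this event, and strictly
     improves on it, since otherwise [Kstar] would itself be a maximizer. *)
  have [K' /andP[K'1 K'max] HK'] : exists2 K', (1 <= K' <= Kmax)%N &
      forall K, (1 <= K <= Kmax)%N -> cr K <= cr K'.
    have P0 : (1 <= (Ordinal (KK : (Kstar < Kmax.+1)%N) : 'I_Kmax.+1))%N by [].
    have [i i1 Hi] := arg_maxP (P := fun i : 'I_Kmax.+1 => (1 <= i)%N)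
      (fun i : 'I_Kmax.+1 => cr i) P0.
    exists i; first by rewrite i1 -ltnS ltn_ord.
    move=> K /andP[K1 KKmax].
    exact: (Hi (Ordinal (KKmax : (K < Kmax.+1)%N))).
  have KsK' : (Kstar < K')%N by apply: hK; split => //; rewrite K'1.
  have lt1 : cr Kstar < cr K'.
    rewrite ltNge; apply/negP => hle.
    suff : (Kstar < Kstar)%N by rewrite ltnn.
    apply: hK; split; first by rewrite Kstar1.
    by move=> K'' hK''; apply: le_trans hle; exact: HK'.
  have ne : ThetaK K' !=set0 by exists thstar; exact: (nest _ _ Kstar1 (ltnW KsK') _ Kthstar).
  (* Nestedness replaces the random order [K'] by the fixed [Kmax] in the likelihood, while its
     penalty is bounded below by that of [Kstar.+1]; one Donsker class then suffices, with no union
     over orders. *)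
  have := supLL_le K' Kmax n w K'1 K'max ne.
  have : D Kstar.+1 <= D K'.
    by move: KsK'; rewrite leq_eqVlt => /orP[/eqP <-//|h]; apply: ltW; exact: Dlt.
  move=> DK supK; have : v n * D Kstar.+1 <= v n * D K'.
    by rewrite ler_wpM2l// ltW// v_gt0.
  by move: lt1; rewrite /cr /crit /c; lra.
Qed.
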